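(* Let $\mu=\sin\frac{\pi}{2(N+2)}$ be the least positive root of $U_{N+1}(x)$ (for $N$ odd), and let $\nu$ be the least positive root of $U'_{N+1}(x)$. For $k=1,\ldots,N$ let $$z_k^{(0)}=(-1)^{k-1}\Bigl(U_{k-1}(\mu)U_k(\mu)-U_{N-k}(\mu)U_{N-k+1}(\mu)+\frac{N+1-2k}{N+1}U_N(\mu)U_{N+1}(\mu)\Bigr),$$ $$z_k^{(1)}=(-1)^{k-1}\Bigl(U_{k-1}(\nu)U_k(\nu)-U_{N-k}(\nu)U_{N-k+1}(\nu)+\frac{N+1-2k}{N+1}U_N(\nu)U_{N+1}(\nu)\Bigr)$$ be the coordinates of the principal vectors of the matrix pencils $I+A-\frac{1}{4\mu^2}(I-B)$ and $I+A-\frac{1}{4\nu^2}(I-B)$, respectively. Then the coefficients of the extremal polynomial of the problem $$\hat J_N=\max\Bigl\{\sum_{j=1}^N\alpha_j:\ \alpha_1=1,\ \sum_{j=1}^N\alpha_j\sin jt\ge0\ \text{for all } t\in[0,\pi]\Bigr\}$$ are given by $$\alpha_k=\frac{\sum_{j=1}^{N-k+1}z_j^{(s)}z_{j+k-1}^{(s)}-\sum_{j=1}^{N-k-1}z_j^{(s)}z_{j+k+1}^{(s)}}{\sum_{j=1}^{N}z_j^{(s)}z_j^{(s)}-\sum_{j=1}^{N-2}z_j^{(s)}z_{j+2}^{(s)}},\qquad k=1,\ldots,N-2,$$ $$\alpha_{N-1}=\frac{z_1^{(s)}z_{N-1}^{(s)}+z_2^{(s)}z_N^{(s)}}{\sum_{j=1}^{N}z_j^{(s)}z_j^{(s)}-\sum_{j=1}^{N-2}z_j^{(s)}z_{j+2}^{(s)}},\qquad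 \alpha_N=\frac{z_1^{(s)}z_N^{(s)}}{\sum_{j=1}^{N}z_j^{(s)}z_j^{(s)}-\sum_{j=1}^{N-2}z_j^{(s)}z_{j+2}^{(s)}},$$ where $s=0$ if $N$ is odd and $s=1$ if $N$ is even.
   Context: $N$ is a positive integer. $U_j$ is the Chebyshev polynomial of the second kind, $U_j(\cos t)=\frac{\sin (j+1)t}{\sin t}$, and $U_j'$ is its derivative. $I$ is the $N\times N$ unit matrix; $A$ and $B$ are the symmetric $N\times N$ matrices whose entries are $\frac12$ at the positions $(i,j)$ with $|i-j|=1$ (for $A$), respectively $|i-j|=2$ (for $B$), and $0$ elsewhere. A principal vector of the pencil $I+A-\lambda(I-B)$ corresponding to the characteristic number $\lambda$ is a generalized eigenvector $Z$, i.e. $(I+A)Z=\lambda(I-B)Z$. The maximum in $\hat J_N$ is over real $\alpha_1=1,\alpha_2,\ldots,\alpha_N$; the extremal polynomial is $\sum_{j=1}^N\alpha_jz^j$ with admissible coefficients attaining the maximum.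
   Formalization: In z_k^(0) the middle term is taken with + instead of −, since as printed z^(0) is identically zero for every odd N and each α_k would be 0/0; z^(0) is treated for N odd only, and ν and z^(1) for N ≥ 2 only, since U_2' has no positive root. *)

(* Defs.v *)
(* MathComp / MathComp-Analysis, over an arbitrary R : realType. *)
From HB Require Import structures.
From mathcomp Require Import all_boot all_order all_algebra.
From mathcomp Require Import zify ring.
From mathcomp Require Import reals trigo.
Set Implicit Arguments.
Unset Strict Implicit.
Unset Printing Implicit Defensive.
Import Order.TTheory GRing.Theory Num.Theory.
Local Open Scope ring_scope.

Section Chebyshev.
Variable R : realType.

(* The pair (U_n, U_{n+1}); see chebU_cos for the trigonometric identity that
   characterizes the U_n. *)
Fixpoint chebU_pair (n : nat) : {poly R} * {poly R} :=
  if n is m.+1 then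
    let: (p, q) := chebU_pair m in (q, 2%:R *: 'X * q - p)
  else (1, 2%:R *: 'X).

Definition chebU (n : nat) : {poly R} := (chebU_pair n).1.

Lemma chebU0 : chebU 0 = 1. Proof. by []. Qed.

Lemma chebU1 : chebU 1 = 2%:R *: 'X. Proof. by []. Qed.

Lemma chebUSS n : chebU n.+2 = 2%:R *: 'X * chebU n.+1 - chebU n.
Proof. by rewrite /chebU /=; case: (chebU_pair n). Qed.

Lemma hornerU0 x : (chebU 0).[x] = 1.
Proof. by rewrite chebU0 hornerE. Qed.

Lemma hornerU1 x : (chebU 1).[x] = 2 * x.
Proof. by rewrite chebU1 !hornerE. Qed.

Lemma hornerUSS n x :
  (chebU n.+2).[x] = 2 * x * (chebU n.+1).[x] - (chebU n).[x].
Proof. by rewrite chebUSS !hornerE. Qed.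

Lemma chebU_cos_mul n t : (chebU n).[cos t] * sin t = sin (n.+1%:R * t).
Proof.
suff: (chebU n).[cos t] * sin t = sin (n.+1%:R * t) /\
      (chebU n.+1).[cos t] * sin t = sin (n.+2%:R * t) by case.
elim: n => [|n [IH1 IH2]].
  rewrite hornerU0 mul1r mul1r hornerU1; split=> //.
  have -> : 2%:R * t = t + t by ring.
  by rewrite sinD; ring.
split=> //; rewrite hornerUSS mulrBl IH1 -[_ * _ * sin t]mulrA IH2.
have -> : n.+3%:R * t = n.+2%:R * t + t by rewrite -[in LHS]natr1; ring.
have -> : n.+1%:R * t = n.+2%:R * t - t by rewrite -[in RHS]natr1; ring.
by rewrite sinB sinD; ring.
Qed.

Lemma chebU_cos n t :
  sin t != 0 -> (chebU n).[cos t] = sin (n.+1%:R * t) / sin t.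
Proof. by move=> t0; rewrite -chebU_cos_mul mulfK. Qed.

(* At a root of U_{N+1}. *)
Lemma chebU_mul_reflect N k x : (chebU N.+1).[x] = 0 -> (0 < k <= N)%N ->
  (chebU (N - k)).[x] * (chebU (N - k).+1).[x]
  = (chebU k.-1).[x] * (chebU k).[x].
Proof.
move=> r0.
have cas n : (chebU n.+1).[x] ^+ 2 - (chebU n.+2).[x] * (chebU n).[x] = 1.
  elim: n => [|n IH].
    by rewrite hornerUSS hornerU1 hornerU0; ring.
  by rewrite -[RHS]IH [(chebU n.+3).[x]]hornerUSS hornerUSS; ring.
have sq : (chebU N).[x] ^+ 2 = 1.
  case: N r0 => [|N] r0; first by rewrite hornerU0 expr1n.
  by rewrite -(cas N) r0 mul0r subr0.
have refl i : (i < N)%N ->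
    (chebU (N - i)).[x] = (chebU N).[x] * (chebU i).[x] /\
    (chebU (N - i.+1)).[x] = (chebU N).[x] * (chebU i.+1).[x].
  elim: i => [|i IH] iN.
    rewrite subn0 subn1 hornerU0 mulr1 hornerU1; split=> //.
    case: N iN r0 {cas sq} => // N _; rewrite hornerUSS /= => /eqP.
    by rewrite subr_eq0 => /eqP <-; ring.
  have [e1 e2] := IH (ltnW iN); split=> //.
  have h : (N - i)%N = (N - i.+2).+2 by lia.
  have h1 : (N - i.+1)%N = (N - i.+2).+1 by lia.
  move: e1 e2; rewrite h h1 hornerUSS => e1 e2.
  rewrite [(chebU i.+2).[x]]hornerUSS mulrBr -e1 e2; ring.
case: k => // k /= kN; have [e1 e2] := refl k kN.
have -> : (N - k.+1).+1 = (N - k)%N by lia.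
by rewrite e1 e2 mulrACA [_ * (chebU N).[x]]mulrC; rewrite -expr2 sq; ring.
Qed.

End Chebyshev.

Definition least_pos_root (R : realType) (p : {poly R}) (x : R) : Prop :=
  [/\ 0 < x, root p x & forall y : R, 0 < y -> root p y -> x <= y].

(* Entries 1/2 where |i - j| = d, and 0 elsewhere: A is the case d = 1 and
   B is the case d = 2. *)
Definition band_mx (R : realType) (N d : nat) : 'M[R]_N :=
  \matrix_(i, j) (if `|(i : nat)%:Z - (j : nat)%:Z| == d%:Z then 2^-1 else 0).

Definition matA (R : realType) (N : nat) : 'M[R]_N := band_mx R N 1.
Definition matB (R : realType) (N : nat) : 'M[R]_N := band_mx R N 2.

(* A principal vector Z of the pencil I + A - lambda (I - B); as for any
   eigenvector, Z is nonzero. *)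
Definition principal_vector (R : realType) (N : nat) (lambda : R)
    (Z : 'cV[R]_N) : Prop :=
  Z != 0 /\
  (1%:M + matA R N) *m Z = lambda *: ((1%:M - matB R N) *m Z).

(* Families z_1, ..., z_N are functions on nat, of which only the values at
   1, ..., N matter; ordinals start at 0, hence the shift. *)
Definition coord_vec (R : realType) (N : nat) (z : nat -> R) : 'cV[R]_N :=
  \col_(i < N) z i.+1.

(* z^(0), to be evaluated at a root x of U_{N+1}.  The second summand carries
   the sign +: by chebU_mul_reflect, the same expression with
   - U_{N-k}(x) U_{N-k+1}(x) vanishes for 1 <= k <= N at such x, so it cannot
   be an eigenvector. *)
Definition zvec0 (R : realType) (N : nat) (x : R) (k : nat) : R :=
  (-1) ^+ k.-1 *
  ((chebU R k.-1).[x] * (chebU R k).[x]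
   + (chebU R (N - k)).[x] * (chebU R (N - k).+1).[x]
   + ((N.+1)%:R - (2 * k)%:R) / (N.+1)%:R
     * (chebU R N).[x] * (chebU R N.+1).[x]).

(* z^(1), to be evaluated at a root x of U'_{N+1}. *)
Definition zvec1 (R : realType) (N : nat) (x : R) (k : nat) : R :=
  (-1) ^+ k.-1 *
  ((chebU R k.-1).[x] * (chebU R k).[x]
   - (chebU R (N - k)).[x] * (chebU R (N - k).+1).[x]
   + ((N.+1)%:R - (2 * k)%:R) / (N.+1)%:R
     * (chebU R N).[x] * (chebU R N.+1).[x]).

(* p = \sum_(1 <= j <= N) alpha_j z^j with alpha_j = p`_j. *)
Definition admissible (R : realType) (N : nat) (p : {poly R}) : Prop :=
  [/\ (size p <= N.+1)%N, p`_0 = 0, p`_1 = 1 &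
      forall t : R, 0 <= t <= pi ->
        0 <= \sum_(1 <= j < N.+1) p`_j * sin (j%:R * t)].

Definition extremal (R : realType) (N : nat) (p : {poly R}) : Prop :=
  admissible N p /\
  forall q : {poly R}, admissible N q ->
    \sum_(1 <= j < N.+1) q`_j <= \sum_(1 <= j < N.+1) p`_j.

Definition alpha_denom (R : realType) (N : nat) (z : nat -> R) : R :=
  \sum_(1 <= j < N.+1) z j * z j - \sum_(1 <= j < N.-1) z j * z j.+2.

(* For N = 1 the coefficient alpha_{N-1} does not exist, hence the guard. *)
Definition coeff_formulas (R : realType) (N : nat) (z : nat -> R)
    (p : {poly R}) : Prop :=
  [/\ forall k : nat, (1 <= k <= N - 2)%N ->
        p`_k = (\sum_(1 <= j < (N - k).+2) z j * z (j + k - 1)%N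
                - \sum_(1 <= j < N - k) z j * z (j + k + 1)%N)
               / alpha_denom N z,
      (1 < N)%N ->
        p`_(N.-1) = (z 1%N * z N.-1 + z 2%N * z N) / alpha_denom N z &
      p`_N = z 1%N * z N / alpha_denom N z].

(* Main.v *)
(* With x = cos t, a sine polynomial sum_k alpha_k sin(k t) is sin t * P(x), and
   the substitution x = 1 - 2 s^2 turns lambda * alpha_1 - sum_k alpha_k, where
   lambda = 1 / (4 nu^2), into a positive multiple of the integral over [-1, 1]
   of P(1 - 2 s^2) (s^2 - nu^2) (1 - s^2)^(1/2) ds.  If nu is the least positive
   root of U_{N+1} (N odd) or of U'_{N+1} (N even), the Gauss, resp. the
   Gauss-Lobatto, rule for this weight has the roots of that polynomial
   (together with +-1 if N is even) as nodes and is exact here.  Its weights are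
   positive, and s^2 - nu^2 vanishes at +-nu and is positive at the other nodes.
   Hence sum_k alpha_k <= lambda * alpha_1 when P >= 0, and in case of equality P
   has prescribed, mostly double, zeros, which determine it up to a factor.
   On the other hand the polynomial |sum_j z_j e^{ijt}|^2 is nonnegative, its
   coefficients are the autocorrelations of z, and the eigenvector equation says
   that it attains the bound. *)
Require Import Defs.
From mathcomp Require Import all_boot all_order all_algebra.
From mathcomp Require Import zify ring lra polyorder polyrcf.
From mathcomp Require Import reals trigo.
Set Implicit Arguments.
Unset Strict Implicit.
Unset Printing Implicit Defensive.
Import Order.TTheory GRing.Theory Num.Theory.
Local Open Scope ring_scope.

(** * Eigenvectors of the pencil *)

Section Pencil.
Variable R : realType.
Implicit Types (N k m d : nat) (x : R).

Local Notation U n x := (chebU R n).[x].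

(** The left side is a quadratic invariant of the three-term recurrence, so it keeps its value at n
    = 0. *)
Lemma chebU_cassini n x : U n.+1 x ^+ 2 - U n.+2 x * U n x = 1.
Proof.
elim: n => [|n IH]; first by rewrite hornerUSS hornerU1 hornerU0; ring.
by rewrite -[RHS]IH [U n.+3 x]hornerUSS [U n.+2 x]hornerUSS; ring.
Qed.

(** The induction carries two consecutive indices, as the recurrence needs both. At a root of
    U'_{n+1} the identity becomes a linear relation between U_n and U_{n+1}. *)
Lemma chebU_deriv n x :
  (1 - x ^+ 2) * (chebU R n.+1)^`().[x]
  = n.+2%:R * U n x - n.+1%:R * x * U n.+1 x.
Proof.
suff: (1 - x ^+ 2) * (chebU R n.+1)^`().[x]
      = n.+2%:R * U n x - n.+1%:R * x * U n.+1 x /\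
      (1 - x ^+ 2) * (chebU R n.+2)^`().[x]
      = n.+3%:R * U n.+1 x - n.+2%:R * x * U n.+2 x by case.
elim: n => [|n [IH1 IH2]].
  by rewrite chebUSS chebU1 chebU0 !derivE !hornerE /=; split; ring.
split=> //; rewrite [chebU R n.+3]chebUSS !derivE !hornerE mulrBr.
rewrite [X in _ - X]IH1.
have -> : (1 - x ^+ 2) * (2 * (chebU R n.+2).[x] +
    2 * x * (chebU R n.+2)^`().[x]) = (1 - x ^+ 2) * 2 * U n.+2 x +
    2 * x * ((1 - x ^+ 2) * (chebU R n.+2)^`().[x]) by ring.
rewrite IH2 !hornerUSS -!(natr1 n.+3) -!(natr1 n.+2) -!(natr1 n.+1) -!(natr1 n).
ring.
Qed.

(* [prodU x m] is U_{k-1}(x) U_k(x) for k = m - 1, extended by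
   U_{-2} U_{-1} = U_{-1} U_0 = 0. *)
Definition prodU x m : R := if m is m'.+2 then U m' x * U m'.+1 x else 0.

(** With x = cos t, sin^2 t U_{k-1} U_k = (cos t - cos((2k+1)t))/2 is a constant plus a cosine of
    frequency 2t in k; hence the factor 2 cos 2t = 4x^2 - 2 and a constant inhomogeneity, which
    [chebU_cassini] evaluates. *)
Lemma prodU_rec x m :
  prodU x m.+2 + prodU x m = (4 * x ^+ 2 - 2) * prodU x m.+1 + 2 * x.
Proof.
case: m => [|[|m]] /=; first by rewrite hornerU1 hornerU0; ring.
  by rewrite hornerUSS hornerU1 hornerU0; ring.
have e0 : U m x = 2 * x * U m.+1 x - U m.+2 x by rewrite hornerUSS; ring.
have h := chebU_cassini m x; rewrite e0 in h.
rewrite [U m.+3 x]hornerUSS e0.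
transitivity ((4 * x ^+ 2 - 2) * (U m.+1 x * U m.+2 x) + 2 * x *
  (U m.+1 x ^+ 2 - U m.+2 x * (2 * x * U m.+1 x - U m.+2 x))); first by ring.
by rewrite h mulr1.
Qed.

(** The hypotheses at j = m, m+1, m+2, combined with weights 1, -2, 1, eliminate b and relate the
    second differences of steps 1 and 2. *)
Lemma rec4_of_rec2 (g : nat -> R) a b m :
  (forall j, (m <= j <= m.+2)%N -> g j.+2 + g j = (a - 2) * g j.+1 + b) ->
  a * (2 * g m.+2 - g m.+1 - g m.+3) = 2 * g m.+2 - g m - g m.+4.
Proof.
move=> h.
have e0 : g m = (a - 2) * g m.+1 + b - g m.+2 by rewrite -h; [ring|lia].
have e1 : g m.+3 = (a - 2) * g m.+2 + b - g m.+1 by rewrite -h; [ring|lia].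
have e2 : g m.+4 = (a - 2) * g m.+3 + b - g m.+2 by rewrite -h; [ring|lia].
by rewrite e2 e0 e1; ring.
Qed.

(* [extvec N 1 x k.+1] and [extvec N (-1) x k.+1] are (-1)^(k-1) times
   [zvec0 N x k] and [zvec1 N x k].  The indices 0, 1, N+2, N+3 correspond to
   k = -1, 0, N+1, N+2: as the entries there vanish, all rows of the pencil
   equation become instances of one recurrence. *)
Definition extvec N (e x : R) m : R :=
  prodU x m + e * prodU x (N.+3 - m)
  + (N.+3%:R - (2 * m)%:R) / N.+1%:R * U N x * U N.+1 x.

(** The reflected product obeys the same recurrence because [prodU_rec] is symmetric in its outer
    indices. The summand affine in m has zero second differences, so it can adjust boundary values
    without disturbing the relation. *)
Lemma extvec_rec4 N (e x : R) m : (m < N)%N ->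
  4 * x ^+ 2 * (2 * extvec N e x m.+2 - extvec N e x m.+1 - extvec N e x m.+3)
  = 2 * extvec N e x m.+2 - extvec N e x m - extvec N e x m.+4.
Proof.
move=> mN.
have h1 := @rec4_of_rec2 (prodU x) (4 * x ^+ 2) (2 * x) m
  (fun j _ => prodU_rec x j).
have h2 := @rec4_of_rec2 (fun j => prodU x (N.+3 - j)) (4 * x ^+ 2) (2 * x) m.
have {}h2 : 4 * x ^+ 2 * (2 * prodU x (N.+3 - m.+2) - prodU x (N.+3 - m.+1) -
   prodU x (N.+3 - m.+3)) = 2 * prodU x (N.+3 - m.+2) - prodU x (N.+3 - m)
   - prodU x (N.+3 - m.+4).
  apply: h2 => j hj; have := prodU_rec x (N.+3 - j.+2).
  have -> : ((N.+3 - j.+2).+2 = N.+3 - j)%N by lia.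
  have -> : ((N.+3 - j.+2).+1 = N.+3 - j.+1)%N by lia.
  by rewrite addrC.
rewrite /extvec.
set L := fun m : nat => (N.+3%:R - (2 * m)%:R) / N.+1%:R * U N x * U N.+1 x.
rewrite -/(L m) -/(L m.+1) -/(L m.+2) -/(L m.+3) -/(L m.+4).
have L1 : 2 * L m.+2 - L m.+1 - L m.+3 = 0 by rewrite /L; ring.
have L2 : 2 * L m.+2 - L m - L m.+4 = 0 by rewrite /L; ring.
transitivity (4 * x ^+ 2 * (2 * prodU x m.+2 - prodU x m.+1 - prodU x m.+3)
  + e * (4 * x ^+ 2 * (2 * prodU x (N.+3 - m.+2) - prodU x (N.+3 - m.+1) -
   prodU x (N.+3 - m.+3))) + 4 * x ^+ 2 * (2 * L m.+2 - L m.+1 - L m.+3)).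
  by ring.
rewrite h1 h2 L1 mulr0 addr0 -[LHS]addr0 -L2; ring.
Qed.

Lemma sum_ord_if_eq N (v : nat -> R) m :
  \sum_(j < N) (if j == m :> nat then v j else 0) = if (m < N)%N then v m else 0.
Proof.
by rewrite -big_mkcond /= -(big_mkord (fun j => j == m) v) big_nat1_eq.
Qed.

Lemma band_mx_mul N d (v : nat -> R) (i : 'I_N) : (0 < d)%N ->
  \sum_(j < N) band_mx R N d i j * v j
  = 2^-1 * ((if (d <= i)%N then v (i - d)%N else 0)
            + (if (i + d < N)%N then v (i + d)%N else 0)).
Proof.
move=> d0.
have -> : (if (d <= i)%N then v (i - d)%N else 0) =
   if (d <= i)%N then \sum_(j < N) (if j == (i - d)%N :> nat then v j else 0)
   else 0.
  by rewrite sum_ord_if_eq (leq_ltn_trans (leq_subr _ _) (ltn_ord i)).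
rewrite -sum_ord_if_eq.
have -> (b : bool) (F : 'I_N -> R) :
   (if b then \sum_j F j else 0) = \sum_j (if b then F j else 0).
  by case: b => //; rewrite big1.
rewrite -big_split mulr_sumr; apply: eq_bigr => j _ /=.
rewrite mxE.
case: ifP => h1; case: ifP => h2; case: eqP => h3; try case: eqP => h4;
  rewrite ?mulr0 ?mul0r ?addr0 ?add0r ?(mulr1, mul1r) ?mulrA ?mulr0 //; lia.
Qed.

(** The alternating sign flips neighbours at distance 1 and preserves those at distance 2, so row i
    of the pencil equation, multiplied by 8x^2, is [rec] at m = i. The four boundary zeros of W
    stand in for the neighbours cut off by the matrix. *)
Lemma principal_vector_of_rec N (z W : nat -> R) (x : R) :
  x != 0 -> W 0%N = 0 -> W 1%N = 0 -> W N.+2 = 0 -> W N.+3 = 0 ->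
  (forall k, (0 < k <= N)%N -> z k = (-1) ^+ k.-1 * W k.+1) ->
  (exists2 k, (0 < k <= N)%N & W k.+1 != 0) ->
  (forall m, (m < N)%N ->
    4 * x ^+ 2 * (2 * W m.+2 - W m.+1 - W m.+3) = 2 * W m.+2 - W m - W m.+4) ->
  principal_vector (1 / (4 * x ^+ 2)) (coord_vec N z).
Proof.
move=> x0 W0 W1 WN2 WN3 zW [k kN Wk] rec; split.
  case: k kN Wk => // k kN Wk; apply/eqP => /colP /(_ (Ordinal kN)).
  rewrite !mxE /= zW // => /eqP; rewrite mulf_eq0 signr_eq0 /=.
  by rewrite (negbTE Wk).
have shift d (i : 'I_N) : (0 < d <= 2)%N ->
    (if (d <= i)%N then z (i - d).+1 else 0)
    + (if (i + d < N)%N then z (i + d).+1 else 0)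
    = (-1) ^+ i * ((-1) ^+ d * (W (i.+2 - d)%N + W (i.+2 + d)%N)).
  move=> hd; have iN := ltn_ord i; rewrite mulrA mulrDr; congr (_ + _).
    case: leqP => di.
      rewrite zW /=; last by lia.
      have -> : (i.+2 - d = (i - d).+2)%N by lia.
      have -> : (-1) ^+ i = (-1) ^+ (i - d) * (-1) ^+ d :> R.
        by rewrite -exprD subnK.
      by rewrite -[_ * _ * (-1) ^+ d]mulrA -expr2 sqrr_sign mulr1.
    have [->|->] : (i.+2 - d = 1 \/ i.+2 - d = 0)%N by lia.
      by rewrite W1 mulr0.
    by rewrite W0 mulr0.
  case: ltnP => di.
    by rewrite zW /= ?addSn ?exprD //; lia.
  have [->|->] : (i.+2 + d = N.+2 \/ i.+2 + d = N.+3)%N by lia.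
    by rewrite WN2 mulr0.
  by rewrite WN3 mulr0.
have bz d (i : 'I_N) : (0 < d <= 2)%N -> (band_mx R N d *m coord_vec N z) i 0
    = 2^-1 * ((-1) ^+ i * ((-1) ^+ d * (W (i.+2 - d)%N + W (i.+2 + d)%N))).
  move=> hd; rewrite -shift // -(band_mx_mul (fun j => z j.+1)); last by lia.
  by rewrite mxE; apply: eq_bigr => j _; rewrite [coord_vec _ _ _ _]mxE.
apply/colP => i; rewrite mulmxDl mulmxBl !mul1mx.
transitivity (coord_vec N z i 0 + (matA R N *m coord_vec N z) i 0).
  by rewrite mxE.
transitivity (1 / (4 * x ^+ 2) *
  (coord_vec N z i 0 - (matB R N *m coord_vec N z) i 0)); last first.
  by rewrite [RHS]mxE; congr (_ * _); rewrite [RHS]mxE; congr (_ + _);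
     rewrite [RHS]mxE.
rewrite !bz // [coord_vec _ _ _ _]mxE zW //=.
have := rec i (ltn_ord i).
rewrite expr1 sqrrN expr1n !addnS addn0 !subSS !subn0 => h.
have x4 : 4 * x ^+ 2 != 0 by rewrite mulf_eq0 pnatr_eq0 expf_eq0 (negbTE x0).
apply: (mulfI x4); rewrite [RHS]mulrA mul1r mulfV // mul1r.

have -> : W i.+4 = 2 * W i.+2 - W i - 4 * x ^+ 2 * (2 * W i.+2 - W i.+1 - W i.+3).
  by rewrite h; ring.
by field.
Qed.
End Pencil.

(** * The vectors z^(0) and z^(1) as principal vectors *)

Section PencilVectors.
Variable R : realType.
Implicit Types (N k m n : nat) (x : R).

Local Notation U n x := (chebU R n).[x].

Lemma zvec0E N x k : (0 < k <= N)%N ->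
  zvec0 N x k = (-1) ^+ k.-1 * extvec N 1 x k.+1.
Proof.
case: k => // k /= kN; rewrite /zvec0 /extvec mul1r.
have -> : (N.+3 - k.+2 = (N - k.+1).+2)%N by lia.
congr (_ * (_ + _ / _ * _ * _)); rewrite !mulnS !natrD -!(natr1 N.+2) -!(natr1 N.+1); ring.
Qed.

Lemma zvec1E N x k : (0 < k <= N)%N ->
  zvec1 N x k = (-1) ^+ k.-1 * extvec N (-1) x k.+1.
Proof.
case: k => // k /= kN; rewrite /zvec1 /extvec mulN1r.
have -> : (N.+3 - k.+2 = (N - k.+1).+2)%N by lia.
congr (_ * (_ + _ / _ * _ * _)); rewrite !mulnS !natrD -!(natr1 N.+2) -!(natr1 N.+1); ring.
Qed.

(** The affine term is scaled to make entry N+2 vanish identically. Entry 1 then vanishes if e = -1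
    or U_{N+1}(x) = 0, which gives the two families; the outermost entries 0 and N+3 impose the
    condition on x. *)
Lemma extvec_ends N (e x : R) :
  [/\ extvec N e x 0 = e * (U N.+1 x * U N.+2 x)
        + N.+3%:R / N.+1%:R * (U N x * U N.+1 x),
      extvec N e x 1 = (e + 1) * (U N x * U N.+1 x),
      extvec N e x N.+2 = 0 &
      extvec N e x N.+3 = U N.+1 x * U N.+2 x
        - N.+3%:R / N.+1%:R * (U N x * U N.+1 x)].
Proof.
have nz : N.+1%:R != 0 :> R by rewrite pnatr_eq0.
have n3 : N.+3%:R = N.+1%:R + 2 :> R by rewrite -natrD addn2.
rewrite /extvec; split.
- by rewrite subn0 /= muln0; ring.
- by rewrite subSS subn0 /= muln1 n3; field; rewrite addrC natr1.
- rewrite !subSS subSnn /=.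
  have -> : (2 * N.+2 = N.+1 + N.+3)%N by lia.
  by rewrite natrD; field; rewrite addrC natr1.
- rewrite subnn /=.
  have -> : (2 * N.+3 = N.+3 + N.+3)%N by lia.
  by rewrite natrD; field; rewrite addrC natr1.
Qed.

Lemma principal_zvec0 N x : (0 < N)%N -> x != 0 -> U N.+1 x = 0 ->
  principal_vector (1 / (4 * x ^+ 2)) (coord_vec N (zvec0 N x)).
Proof.
move=> N0 x0 Ux; have [e0 e1 e2 e3] := extvec_ends N 1 x.
apply: (@principal_vector_of_rec _ _ _ (extvec N 1 x)) => //.
- by rewrite e0 Ux; ring.
- by rewrite e1 Ux; ring.
- by rewrite e3 Ux; ring.
- exact: zvec0E.
(* By reflection both products equal U_0 U_1 = 2x, so the first coordinate is 4x. *)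
- exists 1%N => //; rewrite /extvec Ux !mulr0 addr0 mul1r.
  have -> : prodU x (N.+3 - 2) = 2 * x.
    have -> : (N.+3 - 2 = (N - 1).+2)%N by lia.
    by rewrite /= (chebU_mul_reflect Ux) // hornerU0 hornerU1 mul1r.
  rewrite /= hornerU0 hornerU1.
  have -> : 1 * (2 * x) + 2 * x = 4 * x by ring.
  by rewrite mulf_neq0 // pnatr_eq0.
- by move=> m; apply: extvec_rec4.
Qed.

Lemma chebU_deriv_root n x : (chebU R n.+1)^`().[x] = 0 ->
  n.+2%:R * U n x = n.+1%:R * x * U n.+1 x.
Proof. by move=> h; apply/eqP; rewrite -subr_eq0 -chebU_deriv h mulr0. Qed.

(** At a root of U'_{N+1} one has (N+2) U_N = (N+1) x U_{N+1}, hence (N+1) U_{N+2} = (N+3) U_N: this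
    is what makes the entries 0 and N+3 vanish. *)
Lemma principal_zvec1 N x : (0 < N)%N -> x != 0 -> x ^+ 2 != 1 ->
  (chebU R N.+1)^`().[x] = 0 ->
  principal_vector (1 / (4 * x ^+ 2)) (coord_vec N (zvec1 N x)).
Proof.
move=> N0 x0 x1 /chebU_deriv_root h; have [e0 e1 e2 e3] := extvec_ends N (-1) x.
have nz : N.+1%:R != 0 :> R by rewrite pnatr_eq0.
have n3 : N.+3%:R = N.+1%:R + 2 :> R by rewrite -natrD addn2.
have n2 : N.+2%:R = N.+1%:R + 1 :> R by rewrite natr1.
have UNS : N.+3%:R / N.+1%:R * (U N x * U N.+1 x) = U N.+1 x * U N.+2 x.
  apply: (mulfI nz); rewrite hornerUSS n3.
  transitivity ((N.+1%:R + 2) * (U N x * U N.+1 x)).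
    by field; rewrite addrC natr1.
  move: h; rewrite n2 => h.
  transitivity (U N.+1 x * (2 * (N.+1%:R * x * U N.+1 x) - N.+1%:R * U N x)).
    by rewrite -h; ring.
  by ring.
have W0 : extvec N (-1) x 0 = 0 by rewrite e0 UNS; ring.
have W1 : extvec N (-1) x 1 = 0 by rewrite e1; ring.
apply: (@principal_vector_of_rec _ _ _ (extvec N (-1) x)) => //.
- by rewrite e3 UNS subrr.
- exact: zvec1E.
- exists 1%N => //.
  (* Adding multiples of the vanishing entries 0 and 1 forms a second difference, which [prodU_rec]
     reduces to 4(1 - x^2) U_N U_{N+1}. *)
  have -> : extvec N (-1) x 2
      = extvec N (-1) x 2 + extvec N (-1) x 0 - 2 * extvec N (-1) x 1.
    by rewrite W0 W1; ring.
  rewrite /extvec subn0 !subSS !subn0.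
  have -> : prodU x 2 = (4 * x ^+ 2 - 2) * prodU x 1 + 2 * x - prodU x 0.
    by rewrite -prodU_rec; ring.
  have -> : prodU x N.+3
      = (4 * x ^+ 2 - 2) * prodU x N.+2 + 2 * x - prodU x N.+1.
    by rewrite -prodU_rec; ring.
  set X := (X in X != 0).
  have -> : X = 4 * (1 - x ^+ 2) * (U N x * U N.+1 x).
    by rewrite /X /= !mulnS muln0 !natrD; ring.
  (* By the linear relation at x, a zero of either factor is a zero of both, against the Cassini
     identity or x != 0. *)
  have d0 : U N x * U N.+1 x != 0.
    have c := chebU_cassini N x.
    suff u0 : U N.+1 x != 0.
      rewrite mulf_neq0 //; apply: contra_neq x0 => u.
      apply/eqP; move/eqP: h; rewrite u mulr0 eq_sym !mulf_eq0 (negbTE nz).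
      by rewrite (negbTE u0) orbF.
    apply: contraNneq (oner_neq0 R) => u.
    move/eqP: h; rewrite u mulr0 mulf_eq0 pnatr_eq0 /= => /eqP uN.
    by rewrite -c u uN; apply/eqP; ring.
  by rewrite mulf_neq0 // mulf_neq0 ?pnatr_eq0 // subr_eq0 eq_sym.
- by move=> m; apply: extvec_rec4.
Qed.
End PencilVectors.

(** * Roots of the Chebyshev polynomials *)

Section ChebyshevRoots.
Variable R : realType.
Implicit Types (N k m n : nat) (x : R).

Local Notation U n x := (chebU R n).[x].

Lemma size_chebU n : size (chebU R n) = n.+1.
Proof.
suff: size (chebU R n) = n.+1 /\ size (chebU R n.+1) = n.+2 by case.
elim: n => [|n [IH1 IH2]].
  rewrite chebU0 chebU1 size_poly1 -mul_polyC size_Cmul ?size_polyX //.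
  by rewrite pnatr_eq0.
split=> //; have s : size (2%:R *: 'X * chebU R n.+1) = n.+3.
  rewrite -scalerAl size_scale ?pnatr_eq0 // mulrC size_mulX ?IH2 //.
  by rewrite -size_poly_gt0 IH2.
by rewrite chebUSS size_polyDl ?size_polyN ?s ?IH1 //; lia.
Qed.

Lemma chebU_opp n x : U n (- x) = (-1) ^+ n * U n x.
Proof.
suff: U n (- x) = (-1) ^+ n * U n x /\ U n.+1 (- x) = (-1) ^+ n.+1 * U n.+1 x.
  by case.
elim: n => [|n [IH1 IH2]].
  by rewrite !hornerU0 !hornerU1; split; ring.
by split=> //; rewrite !hornerUSS IH1 IH2 !exprS; ring.
Qed.

Lemma chebU_even_neq0 n : ~~ odd n -> U n 0 != 0.
Proof.
move=> en; rewrite -(even_halfK en); elim: (n./2) => [|m IH].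
  by rewrite hornerU0 oner_eq0.
by rewrite doubleS hornerUSS mulr0 mul0r add0r oppr_eq0.
Qed.

Definition chebU_root n j : R := cos (j.+1%:R * pi / n.+1%:R).

Lemma chebU_angle n j : (j < n)%N -> 0 < j.+1%:R * (pi : R) / n.+1%:R < pi.
Proof.
move=> jn; rewrite divr_gt0 ?mulr_gt0 ?pi_gt0 ?ltr0n //=.
by rewrite ltr_pdivrMr ?ltr0n // mulrC ltr_pM2l ?pi_gt0 // ltr_nat.
Qed.

Lemma sin_natpi n : sin (n%:R * pi) = 0 :> R.
Proof.
elim: n => [|n IH]; first by rewrite mul0r sin0.
by rewrite -natr1 mulrDl mul1r sinDpi IH oppr0.
Qed.

Lemma root_chebU n j : (j < n)%N -> root (chebU R n) (chebU_root n j).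
Proof.
move=> /chebU_angle/sin_gt0_pi s0; apply/eqP.
rewrite /chebU_root chebU_cos ?gt_eqF // mulrCA divff ?pnatr_eq0 // mulr1.
by rewrite sin_natpi mul0r.
Qed.

Lemma chebU_root_lt n i j : (i < j < n)%N -> chebU_root n j < chebU_root n i.
Proof.
move=> /andP[ij jn]; have ha := chebU_angle jn.
have hb := chebU_angle (ltn_trans ij jn).
have itv (t : R) : 0 < t < pi -> t \in `[0, pi].
  by case/andP => a b; rewrite in_itv /= !ltW.
rewrite ltr_cos ?itv // ltr_pM2r ?invr_gt0 ?ltr0n // ltr_pM2r ?pi_gt0 //.
by rewrite ltr_nat.
Qed.

Lemma chebU_root_itv n j : (j < n)%N -> -1 < chebU_root n j < 1.
Proof.
move=> /chebU_angle /andP[a b]; rewrite /chebU_root; apply/andP.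
by split; [rewrite -cospi | rewrite -[ltRHS]cos0];
   rewrite ltr_cos // in_itv /= ?lexx ?pi_ge0 ?ltW.
Qed.

Definition chebU_roots n : seq R := mkseq (chebU_root n) n.

Lemma chebU_roots_sorted n : sorted >%R (chebU_roots n).
Proof.
apply/(sortedP 0) => i; rewrite size_mkseq => h.
rewrite !nth_mkseq; [by apply: chebU_root_lt; rewrite ltnSn | lia | lia].
Qed.

Lemma chebU_roots_root n : all (root (chebU R n)) (chebU_roots n).
Proof.
by apply/allP => x /mapP[j]; rewrite mem_iota add0n => h ->; apply: root_chebU.
Qed.

Lemma gt_sorted_uniq (s : seq R) : sorted >%R s -> uniq s.
Proof.
apply: sorted_uniq => [y x z xy yz | x]; [exact: lt_trans yz xy | exact: ltxx].
Qed.

Lemma chebU_factor n : exists2 c, c != 0 &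
  chebU R n = c *: \prod_(r <- chebU_roots n) ('X - r%:P).
Proof.
exists (lead_coef (chebU R n)).
  by rewrite lead_coef_eq0 -size_poly_gt0 size_chebU.
apply: all_roots_prod_XsubC; rewrite ?chebU_roots_root //.
  by rewrite size_chebU size_mkseq.
by rewrite uniq_rootsE gt_sorted_uniq // chebU_roots_sorted.
Qed.

(** Rolle's theorem is applied between consecutive roots, listed in decreasing order. The lower
    bound by the smallest root serves to confine the new roots to (-1, 1) later. *)
Lemma rolle_path (p : {poly R}) a s :
  path >%R a s -> all (root p) (a :: s) ->
  exists t, [/\ size t = size s, path >%R a t, all (root p^`()) t &
    all (fun x => last a s < x) t].
Proof.
elim: s a => [|b s IH] a; first by exists [::].
move=> /= /andP[ba bs] /and3P[pa pb ps].
have [|t [st bt rt lt]] := IH b bs; first by rewrite /= pb ps.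
have [|c /andP[bc ca] c0] := @poly_rolle _ b a p ba.
  by rewrite (eqP pa) (eqP pb).
rewrite ?bnd_simp in bc ca; exists (c :: t); split=> /=.
- by rewrite st.
- rewrite ca /=; case: t bt {st rt lt} => //= d t /andP[db ->].
  by rewrite (lt_trans db bc).
- by rewrite rt rootE c0 eqxx.
- rewrite lt andbT; apply: le_lt_trans bc.
  elim: s b bs {IH ba ps pb bt lt st} => //= d s IH b /andP[db ds].
  by apply: le_trans (IH d ds) (ltW db).
Qed.

Lemma size_deriv_chebU n : size (chebU R n.+1)^`() = n.+1.
Proof. by rewrite size_deriv ?size_chebU. Qed.

Lemma chebU_deriv_roots n : exists t : seq R,
  [/\ size t = n, uniq t, all (fun x => -1 < x < 1) t,
      all (root (chebU R n.+1)^`()) t &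
      exists2 c, c != 0 &
        (chebU R n.+1)^`() = c *: \prod_(r <- t) ('X - r%:P)].
Proof.
have := chebU_roots_sorted n.+1; have := chebU_roots_root n.+1.
rewrite /chebU_roots /mkseq /=; set a := chebU_root _ 0; set s := map _ _.
move=> hr hs; have [t [st tp tr tl]] := rolle_path hs hr.
have ss : size s = n by rewrite size_map size_iota.
have ut : uniq t by apply: gt_sorted_uniq; apply: path_sorted tp.
exists t; split; rewrite ?st //.
  have /andP[a1 a2] := @chebU_root_itv n.+1 0 isT.
  have l1 : -1 < last a s.
    have /allP : all (fun x => -1 < x) (a :: s).
      apply/allP => x; have -> : a :: s = chebU_roots n.+1 by [].
      case/mapP => j; rewrite mem_iota add0n => h ->.
      by case/andP: (chebU_root_itv h).
    by apply; rewrite mem_last.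
  apply/allP => x xt; rewrite (lt_trans l1 (allP tl x xt)) /=.
  have gt_trans : transitive (>%R : rel R) by move=> y z w ? h; exact: lt_trans h _.
  move: tp; rewrite path_sortedE // => /andP[/allP ha _].
  exact: lt_trans (ha x xt) a2.
exists (lead_coef (chebU R n.+1)^`()).
  by rewrite lead_coef_eq0 -size_poly_gt0 size_deriv_chebU.
by apply: all_roots_prod_XsubC; rewrite ?uniq_rootsE ?size_deriv_chebU ?st ?ss.
Qed.

(** Rolle's theorem is applied between the two largest roots of U_{n+1}; the smaller of them, cos(2
    pi/(n+2)), is nonnegative because n + 2 >= 4. For n = 1, U'_2 = 8x has no positive root. *)
Lemma chebU_deriv_pos_root n : (1 < n)%N ->
  exists2 x : R, 0 < x & root (chebU R n.+1)^`() x.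
Proof.
move=> n1; have hlt := @chebU_root_lt n.+1 0 1 (ltnW n1).
have [|c /andP[bc ca] c0] := @poly_rolle _ _ _ (chebU R n.+1) hlt.
  by rewrite (eqP (@root_chebU n.+1 0 isT)) (eqP (@root_chebU n.+1 1 (ltnW n1))).
rewrite ?bnd_simp in bc ca; exists c; last by apply/eqP.
apply: le_lt_trans bc; apply: cos_ge0_pihalf.
have /andP[/ltW a0 _] := @chebU_angle n.+1 1 (ltnW n1).
apply/andP; split; first by apply: le_trans a0; rewrite oppr_le0 divr_ge0 ?pi_ge0.
rewrite ler_pdivrMr ?ltr0n //.
have h4 : 4 <= n.+2%:R :> R by rewrite ler_nat.
by have := pi_gt0 R; nra.
Qed.

Lemma exists_least_pos_root (p : {poly R}) (s : seq R) :
  (forall x, root p x -> x \in s) -> (exists2 x, 0 < x & root p x) ->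
  exists x, least_pos_root p x.
Proof.
move=> hs [x x0 px].
pose l := sort <=%O [seq y <- s | (0 < y) && root p y].
have lP y : 0 < y -> root p y -> y \in l.
  by move=> y0 py; rewrite mem_sort mem_filter y0 py hs.
have : sorted <=%O l by apply/sort_sorted/le_total.
have : {subset l <= [pred y | (0 < y) && root p y]}.
  by move=> y; rewrite mem_sort mem_filter => /andP[].
have := lP x x0 px; case: l lP => // y l lP _ /(_ y (mem_head _ _)) /andP[y0 py].
move=> /(order_path_min le_trans) /allP ly; exists y; split=> // z z0 pz.
by have := lP z z0 pz; rewrite inE => /orP[/eqP -> //|/ly].
Qed.
End ChebyshevRoots.

(** * Gauss quadrature for discrete Chebyshev moments *)

Section DiscreteMoments.
Variable R : realType.
Implicit Types (N M k m n j : nat) (x : R) (F G p : {poly R}).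

(** The cosines of these angles are the zeros of the first-kind Chebyshev polynomial T_M; finite
    sums over them replace integrals. *)
Definition node M j : R := j.*2.+1%:R * (pi / (2 * M)%:R).

Lemma sum_cos_telescope m (a : R) :
  2 * sin a * (\sum_(j < m) cos (j.*2.+1%:R * a)) = sin ((2 * m)%:R * a).
Proof.
elim: m => [|m IH]; first by rewrite big_ord0 mulr0 muln0 mul0r sin0.
rewrite big_ord_recr /= mulrDr IH mulnS.
have e : (2 * m)%:R * a = m.*2.+1%:R * a - a.
  by rewrite -mul2n -[in RHS]natr1; ring.
have -> : (2 + 2 * m)%:R * a = m.*2.+1%:R * a + a.
  by rewrite natrD -mul2n -[in RHS]natr1; ring.
by rewrite e sinB sinD; ring.
Qed.

(** In the telescoped sum with a = k pi/(2M), the right side is sin(k pi) = 0, while sin a > 0 in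
    the given range of k. *)
Lemma sum_cos_node M k : (0 < k < 2 * M)%N ->
  \sum_(j < M) cos (k%:R * node M j) = 0.
Proof.
move=> /andP[k0 kM]; have M0 : 0 < (2 * M)%:R :> R by rewrite ltr0n; lia.
pose a : R := k%:R * pi / (2 * M)%:R.
have s0 : 0 < sin a.
  apply: sin_gt0_pi; rewrite divr_gt0 ?M0 ?mulr_gt0 ?pi_gt0 ?ltr0n //=.
  by rewrite ltr_pdivrMr // mulrC ltr_pM2l ?pi_gt0 // ltr_nat.
have := sum_cos_telescope M a.
have -> : (2 * M)%:R * a = k%:R * pi.
  by rewrite /a mulrCA divff ?mulr1 // gt_eqF.
rewrite sin_natpi => /eqP; rewrite mulf_eq0 mulf_eq0 pnatr_eq0 (gt_eqF s0) /=.
move=> /eqP h; rewrite -[RHS]h; apply: eq_bigr => j _; congr cos.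
by rewrite /node /a; ring.
Qed.

(** Each factor cos turns the frequency m into m+1 and m-1; the two inequalities keep all resulting
    frequencies strictly between 0 and 2M. *)
Lemma sum_cos_pow_node M m d : (d < m)%N -> (m + d < 2 * M)%N ->
  \sum_(j < M) cos (m%:R * node M j) * cos (node M j) ^+ d = 0.
Proof.
elim: d m => [|d IH] m dm mM.
  under eq_bigr do rewrite expr0 mulr1.
  by apply: sum_cos_node; lia.
case: m dm mM => // m dm mM.
transitivity (2^-1 * ((\sum_(j < M) cos (m.+2%:R * node M j) * cos (node M j) ^+ d)
   + \sum_(j < M) cos (m%:R * node M j) * cos (node M j) ^+ d)).
  rewrite -big_split mulr_sumr; apply: eq_bigr => j _ /=.
  have -> : m.+2%:R * node M j = m.+1%:R * node M j + node M j.
    by rewrite -[in LHS]natr1; ring.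
  have -> : m%:R * node M j = m.+1%:R * node M j - node M j.
    by rewrite -[in RHS]natr1; ring.
  by rewrite cosD cosB exprS; field.
by rewrite (IH m.+2) ?(IH m) ?addr0 ?mulr0; [ | lia..].
Qed.

Lemma sum_cos_poly_node M m G : (size G <= m)%N -> (m + size G <= 2 * M)%N ->
  \sum_(j < M) cos (m%:R * node M j) * G.[cos (node M j)] = 0.
Proof.
move=> Gm mM; under eq_bigr do rewrite horner_coef mulr_sumr.
rewrite exchange_big big1 //= => i _.
transitivity (G`_i * \sum_(j < M) cos (m%:R * node M j) * cos (node M j) ^+ i).
  by rewrite mulr_sumr; apply: eq_bigr => j _; ring.
rewrite sum_cos_pow_node ?mulr0 ?(leq_trans (ltn_ord i)) //.
by apply: leq_trans mM; rewrite ltn_add2l.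
Qed.

(* Up to the factor M/pi, this is the integral of (1 - x^2)^{1/2} F(x) over
   [-1, 1] for polynomials F of degree less than 2M - 2. *)
Definition Lam M F : R :=
  \sum_(j < M) (1 - cos (node M j) ^+ 2) * F.[cos (node M j)].

Lemma LamD M F G : Lam M (F + G) = Lam M F + Lam M G.
Proof.
by rewrite /Lam -big_split; apply: eq_bigr => j _; rewrite hornerD mulrDr.
Qed.

Lemma LamZ M c F : Lam M (c *: F) = c * Lam M F.
Proof.
by rewrite /Lam mulr_sumr; apply: eq_bigr => j _; rewrite hornerZ mulrCA.
Qed.

Lemma Lam0 M : Lam M 0 = 0.
Proof. by rewrite /Lam big1 // => j _; rewrite horner0 mulr0. Qed.

Lemma Lam_sum M (I : Type) (s : seq I) (F : I -> {poly R}) :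
  Lam M (\sum_(i <- s) F i) = \sum_(i <- s) Lam M (F i).
Proof. exact: (big_morph _ (LamD M) (Lam0 M)). Qed.

Lemma node_itv M j : (j < M)%N -> 0 < node M j < pi.
Proof.
move=> jM; have M0 : 0 < (2 * M)%:R :> R by rewrite ltr0n; lia.
rewrite /node mulr_gt0 ?divr_gt0 ?M0 ?pi_gt0 ?ltr0n //=.
rewrite mulrA ltr_pdivrMr // mulrC ltr_pM2l ?pi_gt0 // ltr_nat; lia.
Qed.

Lemma cos_node_itv M j : (j < M)%N -> -1 < cos (node M j) < 1.
Proof.
move=> /node_itv /andP[a b]; apply/andP.
by split; [rewrite -cospi | rewrite -[ltRHS]cos0];
   rewrite ltr_cos // in_itv /= ?lexx ?pi_ge0 ?ltW.
Qed.

Lemma cos_node_uniq M : uniq [seq cos (node M j) | j <- iota 0 M].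
Proof.
rewrite map_inj_in_uniq ?iota_uniq // => i j.
rewrite !mem_iota !add0n => /andP[_ iM] /andP[_ jM] h.
have /andP[/ltW a1 /ltW a2] := node_itv iM.
have /andP[/ltW b1 /ltW b2] := node_itv jM.
have : node M i = node M j by apply: cos_inj => //; rewrite in_itv /= ?a1 ?b1.
move=> /mulIf; have M0 : 0 < (2 * M)%:R :> R by rewrite ltr0n; lia.
rewrite mulf_neq0 ?invr_eq0 ?(gt_eqF M0) ?(gt_eqF (pi_gt0 R)) // => /(_ isT)/eqP.
by rewrite eqr_nat => /eqP; lia.
Qed.

Lemma one_sub_sqr_gt0 x : -1 < x < 1 -> 0 < 1 - x ^+ 2.
Proof. by move=> /andP[a b]; nra. Qed.

(** All terms are nonnegative, and a nonzero polynomial of degree below M cannot vanish at all M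
    distinct nodes. *)
Lemma Lam_gt0 M F : F != 0 -> (size F <= M)%N ->
  (forall x, -1 < x < 1 -> 0 <= F.[x]) -> 0 < Lam M F.
Proof.
move=> F0 sF Fge.
have tge (j : 'I_M) : true ->
    0 <= (1 - cos (node M j) ^+ 2) * F.[cos (node M j)].
  move=> _; have h := cos_node_itv (ltn_ord j).
  by rewrite mulr_ge0 ?Fge // ltW // one_sub_sqr_gt0.
rewrite lt_def sumr_ge0 // andbT; apply: contraNneq F0 => h0.
apply/eqP/(roots_geq_poly_eq0 _ (cos_node_uniq M)); last first.
  by rewrite size_map size_iota.
apply/allP => x /mapP[j]; rewrite mem_iota add0n => /andP[_ jM] ->.
have := psumr_eq0P tge h0 (i := Ordinal jM) isT => /eqP.
by rewrite mulf_eq0 gt_eqF // one_sub_sqr_gt0 // cos_node_itv.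
Qed.

(* The [Fx x] need not be the Lagrange polynomials: squares of higher degree are
   allowed, and they make the weights positive. *)
Lemma gauss_quadrature M D (xs : seq R) (Fx : R -> {poly R}) :
  uniq xs ->
  (forall x, x \in xs -> [/\ (size (Fx x) <= D)%N, (Fx x).[x] != 0 &
     forall y, y \in xs -> y != x -> (Fx x).[y] = 0]) ->
  (forall G, (size xs + size G <= D)%N ->
     Lam M (\prod_(x <- xs) ('X - x%:P) * G) = 0) ->
  forall F, (size F <= D)%N ->
    Lam M F = \sum_(x <- xs) Lam M (Fx x) / (Fx x).[x] * F.[x].
Proof.
move=> uxs hF hO F sF.
(* r agrees with F on [xs], so F - r is a multiple of the node polynomial and [hO] annihilates
   it. *)
pose r := \sum_(x <- xs) (F.[x] / (Fx x).[x]) *: Fx x.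
have -> : \sum_(x <- xs) Lam M (Fx x) / (Fx x).[x] * F.[x] = Lam M r.
  rewrite Lam_sum; apply: eq_bigr => x _; rewrite LamZ; ring.
have -> : F = (F - r) + r by rewrite subrK.
rewrite LamD.
suff -> : Lam M (F - r) = 0 by rewrite add0r.
have sr : (size (F - r)%R <= D)%N.
  rewrite (leq_trans (size_polyD _ _)) // size_polyN geq_max sF /=.
  rewrite /r big_seq; elim/big_ind: _ => [|p q sp sq|x xs_x].
  - by rewrite size_poly0.
  - by rewrite (leq_trans (size_polyD _ _)) // geq_max sp.
  - by rewrite (leq_trans (size_scale_leq _ _)) //; case: (hF x xs_x).
have : all (root (F - r)) xs.
  apply/allP => y ys; rewrite rootE hornerD hornerN horner_sum.
  rewrite (bigD1_seq y) //= big_seq_cond big1 => [|x /andP[xx xy]].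
    by case: (hF y ys) => _ n0 _; rewrite hornerZ addr0 divfK // subrr.
  by case: (hF x xx) => _ _ h; rewrite hornerZ (h y ys) ?mulr0 // eq_sym.
move=> /uniq_roots_prod_XsubC; rewrite uniq_rootsE => /(_ uxs) [q eq].
have [q0|qn0] := eqVneq q 0; first by rewrite eq q0 mul0r Lam0.
rewrite eq mulrC hO //; move: sr; rewrite eq.
by rewrite size_Mmonic ?monic_prod_XsubC // size_prod_XsubC addnS /= addnC.
Qed.

(** With x = cos t, (1 - x^2) U_{N+1} = sin t sin((N+2)t) is half of cos((N+1)t) - cos((N+3)t), and
    both frequencies exceed the degree of G. *)
Lemma Lam_chebU_orth N M G : (size G <= N.+1)%N -> (N.*2 + 10 <= M)%N ->
  Lam M (chebU R N.+1 * G) = 0.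
Proof.
move=> sG hM.
transitivity (2^-1 * (\sum_(j < M) cos (N.+1%:R * node M j) * G.[cos (node M j)])
  - 2^-1 * (\sum_(j < M) cos (N.+3%:R * node M j) * G.[cos (node M j)])).
  rewrite !mulr_sumr -sumrB; apply: eq_bigr => j _; set a := node M j.
  rewrite hornerM -sin2cos2 expr2 mulrA -[sin a * sin a * _]mulrA.
  rewrite [sin a * (chebU _ _).[_]]mulrC chebU_cos_mul.
  have -> : N.+1%:R * a = N.+2%:R * a - a by rewrite -[in RHS]natr1; ring.
  have -> : N.+3%:R * a = N.+2%:R * a + a by rewrite -[in LHS]natr1; ring.
  by rewrite cosB cosD; field.
by rewrite !sum_cos_poly_node ?mulr0 ?subrr //; lia.
Qed.

(** By [chebU_deriv], (1 - x^2)^2 U'_{N+1} is a combination of cosines of frequencies N, N+2 and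
    N+4; the lowest one dictates the bound on the size of G. *)
Lemma Lam_chebU_deriv_orth N M G : (size G <= N)%N -> (N.*2 + 10 <= M)%N ->
  Lam M ((1 - 'X^2) * (chebU R N.+1)^`() * G) = 0.
Proof.
move=> sG hM.
transitivity (
  N.+3%:R / 4 * (\sum_(j < M) cos (N%:R * node M j) * G.[cos (node M j)])
  - N.+2%:R / 2 * (\sum_(j < M) cos (N.+2%:R * node M j) * G.[cos (node M j)])
  + N.+1%:R / 4 * (\sum_(j < M) cos (N.+4%:R * node M j) * G.[cos (node M j)])).
  rewrite !mulr_sumr -sumrB -big_split; apply: eq_bigr => j _ /=.
  set a := node M j.
  have h1 := chebU_cos_mul N a; have h2 := chebU_cos_mul N.+1 a.
  rewrite !hornerM hornerD hornerN hornerXn -polyC1 hornerC chebU_deriv mulrA.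
  have -> : (1 - cos a ^+ 2) * (N.+2%:R * (chebU R N).[cos a]
      - N.+1%:R * cos a * (chebU R N.+1).[cos a])
    = sin a * (N.+2%:R * sin (N.+1%:R * a) - N.+1%:R * cos a * sin (N.+2%:R * a)).
    by rewrite -h1 -h2 -sin2cos2; ring.
  set b := N.+2%:R * a.
  have -> : N.+1%:R * a = b - a by rewrite /b -(natr1 N.+1); ring.
  have -> : N%:R * a = b - (a + a) by rewrite /b -(natr1 N.+1) -(natr1 N); ring.
  have -> : N.+4%:R * a = b + (a + a) by rewrite /b -(natr1 N.+3) -(natr1 N.+2); ring.
  have -> : N.+3%:R = N.+2%:R + 1 :> R by rewrite natr1.
  have -> : N.+2%:R = N.+1%:R + 1 :> R by rewrite natr1.
  (* Inserting cos^2 + sin^2 homogenizes this term, so that the identity becomes purely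
     algebraic. *)
  have c1 : (N.+1%:R + 1) / 2 * (cos b * G.[cos a]) = 
    (N.+1%:R + 1) / 2 * (cos b * G.[cos a]) * (cos a ^+ 2 + sin a ^+ 2).
    by rewrite cos2Dsin2 mulr1.
  rewrite c1 !sinB !cosB !cosD !sinD.
  by field.
by rewrite !sum_cos_poly_node ?mulr0 ?subrr ?addr0 //; lia.
Qed.

End DiscreteMoments.

(** * Nonnegative polynomials and quadrature *)

Section Certificate.
Variable R : realType.
Implicit Types (N M k m n j : nat) (x r nu : R) (F G p g : {poly R}) (rs es : seq R).

(** If g(r) were nonzero, g would keep its sign near r and p would be negative on one side. The step
    [dd] stays within the continuity radius and within (-1, 1). *)
Lemma nonneg_double_root p g r : -1 < r < 1 -> p = ('X - r%:P) * g ->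
  (forall x, -1 < x < 1 -> 0 <= p.[x]) -> g.[r] = 0.
Proof.
move=> /andP[r1 r2] -> pge; apply/eqP; apply: contraT => g0.
have e0 : 0 < `|g.[r]| by rewrite normr_gt0.
have [d d0 hd] := poly_cont r g e0.
pose dd := Num.min (d / 2) (Num.min ((1 - r) / 2) ((1 + r) / 2)).
have dd0 : 0 < dd by rewrite !lt_min !divr_gt0 //= ?subr_gt0 //; lra.
have /and3P[dd1 dd2 dd3] : [&& dd <= d / 2, dd <= (1 - r) / 2 & dd <= (1 + r) / 2].
  by rewrite !ge_min !lexx !orbT.
have [gr|gr|gr] := ltrgt0P g.[r].
- have := hd (r - dd); rewrite (gtr0_norm gr) addrAC subrr add0r normrN gtr0_norm //.
  have -> : dd < d by lra.
  move=> /(_ isT); rewrite ltr_distl subrr => /andP[gy _].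
  have := pge (r - dd); rewrite hornerM hornerXsubC addrAC subrr add0r.
  have -> : -1 < r - dd < 1 by apply/andP; split; lra.
  by move=> /(_ isT); rewrite mulNr oppr_ge0 leNgt mulr_gt0.
- have := hd (r + dd); rewrite (ltr0_norm gr) addrAC subrr add0r gtr0_norm //.
  have -> : dd < d by lra.
  move=> /(_ isT); rewrite ltr_distl subrr => /andP[_ gy].
  have := pge (r + dd); rewrite hornerM hornerXsubC addrAC subrr add0r.
  have -> : -1 < r + dd < 1 by apply/andP; split; lra.
  by move=> /(_ isT); rewrite pmulr_rge0 // leNgt gy.
- by rewrite gr eqxx in g0.
Qed.

(** In [quad_size] the interior nodes [rs] count twice, since a nonnegative polynomial has double
    zeros there; the nodes [es], meant for the endpoints, count once. *)
Record quadrature N M nu rs es (w : R -> R) : Prop := Quadrature {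
  quad_uniq : uniq (es ++ rs);
  quad_size : ((size rs).*2 + size es)%N = N.*2.+2;
  quad_rs : forall x, x \in rs -> -1 < x < 1;
  quad_es : forall x, x \in es -> -1 <= x <= 1;
  quad_gt0 : 0 < nu;
  quad_nu : nu \in rs;
  quad_nuN : - nu \in rs;
  quad_far : forall x, x \in es ++ rs -> x != nu -> x != - nu ->
    nu ^+ 2 < x ^+ 2;
  quad_w : forall x, x \in es ++ rs -> 0 < w x;
  quad_exact : forall F, (size F <= N.*2.+2)%N ->
    Lam M F = \sum_(x <- es ++ rs) w x * F.[x] }.

(* The nodes other than +-nu, those of [rs] with multiplicity two. *)
Definition quad_cofactor nu rs es : {poly R} :=
  let rs' := rem (- nu) (rem nu rs) in
  \prod_(x <- rs') ('X - x%:P) * \prod_(x <- es ++ rs') ('X - x%:P).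

Variables (N M : nat) (nu : R) (rs es : seq R) (w : R -> R).
Hypothesis Q : quadrature N M nu rs es w.

Local Notation rs' := (rem (- nu) (rem nu rs)).

Lemma quad_rem_uniq : uniq (es ++ rs').
Proof.
have := quad_uniq Q; rewrite !cat_uniq => /and3P[-> h1 h2] /=.
rewrite !rem_uniq // andbT; apply: contra h1 => /hasP[x xr xe].
by apply/hasP; exists x => //; exact: mem_rem (mem_rem xr).
Qed.

Lemma mem_quad_rem x :
  (x \in es ++ rs') -> [/\ x \in es ++ rs, x != nu & x != - nu].
Proof.
have nn : - nu \in rem nu rs.
  have := quad_uniq Q; rewrite cat_uniq => /and3P[_ _ u].
  rewrite mem_rem_uniq // inE (quad_nuN Q) andbT.
  by have := quad_gt0 Q => h; apply/eqP; lra.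
have := quad_uniq Q; rewrite cat_uniq => /and3P[_ /hasP hn u].
rewrite mem_cat => /orP[xe|].
  rewrite mem_cat xe; split=> //; apply/eqP => xn; apply: hn.
    by exists nu; rewrite ?(quad_nu Q) //= -xn.
  by exists (- nu); rewrite ?(quad_nuN Q) //= -xn.
rewrite mem_rem_uniq ?rem_uniq // inE mem_rem_uniq // inE => /and3P[-> -> xr].
by rewrite mem_cat xr orbT.
Qed.

Lemma size_quad_rem : (size rs = (size rs').+2)%N.
Proof.
have := quad_uniq Q; rewrite cat_uniq => /and3P[_ _ u].
have nn : - nu \in rem nu rs.
  rewrite mem_rem_uniq // inE (quad_nuN Q) andbT.
  by have := quad_gt0 Q => h; apply/eqP; lra.
have := nn; have := quad_nu Q; rewrite -!index_mem.
move=> /(leq_ltn_trans (leq0n _)) h1 /(leq_ltn_trans (leq0n _)) h2.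
rewrite size_rem // size_rem ?(quad_nu Q) //.
by move: h1 h2; rewrite size_rem ?(quad_nu Q) //; case: (size rs) => [|[|n]].
Qed.

(** Dropping two double nodes leaves degree 2N + 2 - 4 = 2N - 2, the largest degree that [psize]
    allows for p. *)
Lemma quad_cofactor_size : size (quad_cofactor nu rs es) = N.*2.-1.
Proof.
rewrite size_Mmonic ?monic_prod_XsubC ?monic_neq0 ?monic_prod_XsubC //.
rewrite !size_prod_XsubC size_cat.
have := quad_size Q; rewrite size_quad_rem.
by move: (size rs') (size es) => n m; lia.
Qed.

Lemma itvW x : -1 < x < 1 -> -1 <= x <= 1.
Proof. by move=> /andP[/ltW -> /ltW ->]. Qed.

Variable p : {poly R}.
Hypothesis psize : (size p <= N.*2.-1)%N.
Hypothesis pge0 : forall x, -1 <= x <= 1 -> 0 <= p.[x].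

Local Notation Lp := (Lam M (p * ('X^2 - (nu ^+ 2)%:P))).

Lemma quad_LpE : Lp = \sum_(x <- es ++ rs) w x * (p.[x] * (x ^+ 2 - nu ^+ 2)).
Proof.
rewrite (quad_exact Q).
  by apply: eq_bigr => x _; rewrite hornerM hornerD hornerN hornerXn hornerC.
apply: leq_trans (size_polyMleq _ _) _; rewrite size_XnsubC //.
by move: psize; lia.
Qed.

Lemma quad_term_ge0 x : x \in es ++ rs ->
  0 <= w x * (p.[x] * (x ^+ 2 - nu ^+ 2)).
Proof.
move=> xs; rewrite mulr_ge0 ?(ltW (quad_w Q xs)) // mulr_ge0 //.
  apply: pge0; move: xs; rewrite mem_cat => /orP[/(quad_es Q) //|].
  by move=> /(quad_rs Q) /andP[/ltW -> /ltW ->].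
rewrite subr_ge0; have [->//|n1] := eqVneq x nu.
have [->|n2] := eqVneq x (- nu); first by rewrite sqrrN.
by rewrite ltW // (quad_far Q).
Qed.

Lemma quad_ge0 : 0 <= Lp.
Proof. by rewrite quad_LpE big_seq sumr_ge0 // => x; apply: quad_term_ge0. Qed.

(** A vanishing sum of nonnegative terms makes p zero at every node except +-nu. The interior zeros
    are double, and the degree leaves only a constant factor. *)
Lemma quad_eq0 : Lp = 0 -> exists a, p = a *: quad_cofactor nu rs es.
Proof.
rewrite quad_LpE => h.
have pz x : x \in es ++ rs' -> p.[x] = 0.
  move=> /mem_quad_rem[xs n1 n2].
  have := h; rewrite (bigD1_seq x) ?(quad_uniq Q) //=.
  have s0 : 0 <= \sum_(i <- es ++ rs | i != x) w i * (p.[i] * (i ^+ 2 - nu ^+ 2)).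
    rewrite big_seq_cond sumr_ge0 // => y /andP[ys _]; exact: quad_term_ge0.
  move/eqP; rewrite paddr_eq0 ?quad_term_ge0 // => /andP[+ _].
  have wx := quad_w Q xs; have fx := quad_far Q xs n1 n2.
  by rewrite !mulf_eq0 (gt_eqF wx) /= subr_eq0 (gt_eqF fx) orbF => /eqP.
have ar : all (root p) (es ++ rs') by apply/allP => x /pz/eqP.
have [q pq] := uniq_roots_prod_XsubC ar (etrans (uniq_rootsE _) quad_rem_uniq).
have qr : all (root q) rs'.
  apply/allP => r rr; have rer : r \in es ++ rs' by rewrite mem_cat rr orbT.
  have r1 : -1 < r < 1.
    by apply: (quad_rs Q); exact: mem_rem (mem_rem rr).
  (* Once X - r is split off, the cofactor of p is q times a product that does not vanish at r, so
     the double zero passes to q. *)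
  move: pq; rewrite (bigD1_seq r) ?quad_rem_uniq //= mulrCA => pq.
  have := nonneg_double_root r1 pq.
  rewrite hornerM => g0; have {g0}/eqP := g0 (fun x hx => pge0 (itvW hx)).
  rewrite mulf_eq0 => /orP[//|].
  move=> hp; exfalso; move: hp; rewrite horner_prod prodf_seq_eq0.
  move=> /hasP[y _ /andP[yr]]; rewrite hornerXsubC subr_eq0 => /eqP ry.
  by rewrite ry eqxx in yr.
have ur : uniq rs' by have := quad_rem_uniq; rewrite cat_uniq => /and3P[].
have [g qg] := uniq_roots_prod_XsubC qr (etrans (uniq_rootsE _) ur).
have pg : p = g * quad_cofactor nu rs es by rewrite pq qg -mulrA.
have [g0|gn0] := eqVneq g 0; first by exists 0; rewrite pg g0 mul0r scale0r.
have : (size g <= 1)%N.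
  have gs : (0 < size g)%N by rewrite size_poly_gt0.
  have mc : quad_cofactor nu rs es \is monic.
    by rewrite rpredM ?monic_prod_XsubC.
  have := psize; rewrite pg size_Mmonic // quad_cofactor_size.
  have := quad_size Q; rewrite size_quad_rem.
  by move: (size rs') (size es) (size g) gs => n m k; lia.
move=> /size1_polyC gc; exists g`_0; by rewrite pg {1}gc mul_polyC.
Qed.
End Certificate.

(** * Gauss and Gauss-Lobatto rules *)

Section QuadratureInstances.
Variable R : realType.
Implicit Types (N M k m n j : nat) (x y r nu : R) (F G p q : {poly R}) (rs es : seq R).

(** The test polynomial at x is V x times the square of the product over the other interior nodes; V
    x supplies the zeros at the other endpoints. Being nonnegative on (-1, 1) and positive at x, it
    gives a positive weight. *)
Lemma quadrature_intro N M nu q c rs es (V : R -> {poly R}) :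
  (N.*2 + 10 <= M)%N -> c != 0 -> q = c *: \prod_(r <- rs) ('X - r%:P) ->
  uniq (es ++ rs) -> ((size rs).*2 + size es)%N = N.*2.+2 ->
  (forall x, x \in rs -> -1 < x < 1) -> (forall x, x \in es -> x ^+ 2 = 1) ->
  least_pos_root q nu -> ~~ root q 0 -> (forall x, root q x -> root q (- x)) ->
  (forall x, x \in es ++ rs ->
    [/\ 0 < (V x).[x], forall y, -1 < y < 1 -> 0 <= (V x).[y],
        forall y, y \in es -> y != x -> (V x).[y] = 0 &
        (size (V x) + (size rs - (x \in rs)).*2 <= N.*2.+2)%N]) ->
  (forall G, (size (es ++ rs) + size G <= N.*2.+2)%N ->
    Lam M (\prod_(x <- es ++ rs) ('X - x%:P) * G) = 0) ->
  exists w, quadrature N M nu rs es w.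
Proof.
move=> hM c0 qE uxs hsz hrs hes [nu0 qnu nu_min] q0 qN hV hO.
have urs : uniq rs by move: uxs; rewrite cat_uniq => /and3P[].
have rq x : root q x = (x \in rs) by rewrite qE rootZ // root_prod_XsubC.
have ers x : x \in es -> x \notin rs.
  by move=> xe; apply/negP => /hrs /one_sub_sqr_gt0; rewrite hes // subrr ltxx.
pose P x := \prod_(y <- rem x rs) ('X - y%:P).
pose Fx x := V x * P x ^+ 2.
have Pxx x : (P x).[x] != 0.
  rewrite -rootE root_prod_XsubC; have [xr|xr] := boolP (x \in rs).
    by rewrite mem_rem_uniq // inE eqxx.
  by rewrite rem_id.
have Fxx x : x \in es ++ rs -> 0 < (Fx x).[x].
  move=> /hV[v0 _ _ _]; rewrite hornerM horner_exp mulr_gt0 //.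
  by rewrite lt_def sqr_ge0 expf_neq0.
have Fx0 x y : x \in es ++ rs -> y \in es ++ rs -> y != x -> (Fx x).[y] = 0.
  move=> /hV[_ _ ve _]; rewrite mem_cat => /orP[ye|yr] yx.
    by rewrite hornerM ve // mul0r.
  rewrite hornerM horner_exp; suff -> : (P x).[y] = 0 by rewrite expr0n mulr0.
  by apply/eqP; rewrite -rootE root_prod_XsubC mem_rem_uniq // inE yx.
have sFx x : x \in es ++ rs -> (size (Fx x) <= N.*2.+2)%N.
  move=> /hV[_ _ _]; apply: leq_trans; apply: leq_trans (size_polyMleq _ _) _.
  have mP : P x \is monic by rewrite monic_prod_XsubC.
  have -> : size (P x ^+ 2) = ((size rs - (x \in rs)).*2.+1)%N.
    rewrite expr2 size_Mmonic ?monic_neq0 // size_prod_XsubC.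
    have -> : size (rem x rs) = (size rs - (x \in rs))%N.
      have [xr|xr] := boolP (x \in rs); first by rewrite size_rem // subn1.
      by rewrite rem_id // subn0.
    by rewrite addnn /=.
  by rewrite addnS.
have Fxge x y : x \in es ++ rs -> -1 < y < 1 -> 0 <= (Fx x).[y].
  by move=> /hV[_ vy _ _] hy; rewrite hornerM horner_exp mulr_ge0 ?vy // sqr_ge0.
exists (fun x => Lam M (Fx x) / (Fx x).[x]); split=> //.
- by move=> x /hes h; apply/andP; split; nra.
- by rewrite -rq.
- by rewrite -rq qN.
(* An endpoint has square 1 > nu^2. For an interior root, minimality of nu applies to x or, by
   symmetry, to -x, and 0 is not a root. *)
- move=> x; rewrite mem_cat => /orP[/hes ->|xr] n1 n2.
    by rewrite -subr_gt0 one_sub_sqr_gt0 // hrs // -rq.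
  have [x0|x0|x0] := ltrgt0P x.
  + have := nu_min x x0; rewrite rq => /(_ xr); rewrite le_eqVlt eq_sym (negbTE n1) /=.
    by move=> h; nra.
  + have := nu_min (- x); rewrite oppr_gt0 => /(_ x0).
    rewrite qN ?rq // => /(_ isT); rewrite le_eqVlt eq_sym eqr_oppLR (negbTE n2) /=.
    by move=> h; nra.
  + by move: xr; rewrite -rq x0 (negbTE q0).
- move=> x xs; rewrite divr_gt0 ?Fxx // Lam_gt0 //.
  + by apply: contraTneq (Fxx x xs) => ->; rewrite horner0 ltxx.
  + by apply: leq_trans (sFx x xs) _; lia.
  + by move=> y; apply: Fxge.
- apply: gauss_quadrature => // x xs; split; rewrite ?sFx //.
    by rewrite gt_eqF // Fxx.
  by move=> y ys yx; apply: Fx0.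
Qed.

Lemma quadrature_odd N M (mu : R) : odd N -> (N.*2 + 10 <= M)%N ->
  least_pos_root (chebU R N.+1) mu -> exists rs es w, quadrature N M mu rs es w.
Proof.
move=> oN hM hmu; have [c c0 cE] := chebU_factor R N.+1.
exists (chebU_roots R N.+1), [::].
apply: (quadrature_intro (V := fun _ => 1) hM c0 cE) => //.
- exact: gt_sorted_uniq (chebU_roots_sorted R N.+1).
- by rewrite size_mkseq addn0.
- by move=> x /mapP[j]; rewrite mem_iota add0n => h ->; apply: chebU_root_itv.
- by rewrite chebU_even_neq0 //= oN.
- by move=> x; rewrite !rootE chebU_opp => /eqP ->; rewrite mulr0.
- move=> x xr; split; rewrite ?hornerE ?ltr01 //.
    by move=> y _; rewrite hornerE ler01.
  rewrite cat0s in xr; by rewrite size_poly1 size_mkseq xr; lia.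
- move=> G; rewrite size_mkseq => sG.
  have -> : \prod_(x <- chebU_roots R N.+1) ('X - x%:P) = c^-1 *: chebU R N.+1.
    by rewrite cE scalerA mulVf // scale1r.
  by rewrite -scalerAl LamZ Lam_chebU_orth ?mulr0 //; lia.
Qed.

Lemma quadrature_even N M (nu : R) : (0 < N)%N -> ~~ odd N -> (N.*2 + 10 <= M)%N ->
  least_pos_root (chebU R N.+1)^`() nu -> exists rs es w, quadrature N M nu rs es w.
Proof.
move=> N0 eN hM hnu.
have [t [st ut ti tr [c c0 cE]]] := chebU_deriv_roots R N.
have tit x : x \in t -> -1 < x < 1 by move=> /(allP ti).
exists t, [:: 1; -1].
(* Each choice vanishes at the endpoints other than x at the least possible degree. *)
pose V x : {poly R} := if x == 1 then 1 + 'X else if x == -1 then 1 - 'X else 1 - 'X^2.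
have n11 : (-1 == 1 :> R) = false by apply/eqP; lra.
apply: (quadrature_intro (V := V) hM c0 cE) => //.
- rewrite /= inE eq_sym n11 ut andbT /=; apply/andP; split.
    by apply/negP => /tit; rewrite ltxx andbF.
  by apply/negP => /tit; rewrite ltxx.
- by rewrite st /=; lia.
- by move=> x; rewrite !inE => /orP[] /eqP ->; rewrite ?sqrrN expr1n.
(* U'_{N+1}(0) = (N+2) U_N(0), which is nonzero for even N. *)
- have := chebU_deriv N (0 : R); rewrite expr0n subr0 mul1r mulr0 mul0r subr0 rootE => ->.
  by rewrite mulf_neq0 ?pnatr_eq0 // chebU_even_neq0.
- move=> x; have := chebU_deriv N x; have := chebU_deriv N (- x).
  rewrite sqrrN !chebU_opp !rootE => h1 h2 /eqP h3.
  have x1 : 1 - x ^+ 2 != 0.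
    rewrite gt_eqF // one_sub_sqr_gt0 // tit //.
    have : root (chebU R N.+1)^`() x by rewrite rootE h3.
    by rewrite cE rootZ // root_prod_XsubC.
  apply/eqP/(mulfI x1); rewrite h1 mulr0.
  transitivity ((-1) ^+ N * ((1 - x ^+ 2) * (chebU R N.+1)^`().[x])).
    by rewrite h2 exprS; ring.
  by rewrite h3 !mulr0.
- move=> x; rewrite mem_cat !inE -orbA => /or3P[/eqP ->|/eqP ->|xt].
  + have nt : 1 \notin t by apply/negP => /tit; rewrite ltxx andbF.
    rewrite /V eqxx (negbTE nt) st; split.
    * by rewrite !hornerE; lra.
    * by move=> y /andP[a b]; rewrite !hornerE; lra.
    * move=> y; rewrite !inE => /orP[] /eqP -> //; rewrite ?eqxx // => _.
      by rewrite !hornerE; lra.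
    * have -> : 1 + 'X = 'X - (-1)%:P :> {poly R} by rewrite polyCN opprK addrC.
      by rewrite size_XsubC; lia.
  + have nt : -1 \notin t by apply/negP => /tit; rewrite ltxx.
    rewrite /V n11 eqxx (negbTE nt) st; split.
    * by rewrite !hornerE; lra.
    * by move=> y /andP[a b]; rewrite !hornerE; lra.
    * move=> y; rewrite !inE => /orP[] /eqP -> //; rewrite ?eqxx // => _.
      by rewrite !hornerE; lra.
    * by rewrite -opprB size_polyN -polyC1 size_XsubC; lia.
  + have x1 := one_sub_sqr_gt0 (tit x xt).
    have xe1 : (x == 1) = false.
      by apply/eqP => h; move: x1; rewrite h expr1n subrr ltxx.
    have xe2 : (x == -1) = false.
      by apply/eqP => h; move: x1; rewrite h sqrrN expr1n subrr ltxx.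
    rewrite /V xe1 xe2 xt st; split.
    * by rewrite !hornerE.
    * by move=> y /one_sub_sqr_gt0 /ltW; rewrite !hornerE.
    * move=> y; rewrite !inE => /orP[] /eqP -> _; rewrite !hornerE; lra.
    * by rewrite -opprB size_polyN -polyC1 size_XnsubC //; lia.
- move=> G; rewrite size_cat st /= => sG.
  have -> : \prod_(x <- [:: 1; -1] ++ t) ('X - x%:P)
       = (- c^-1) *: ((1 - 'X^2) * (chebU R N.+1)^`()).
    rewrite cE -scalerAr scalerA mulNr mulVf // scaleN1r big_cat !big_cons big_nil /=.
    by rewrite polyCN polyC1; ring.
  by rewrite -scalerAl LamZ Lam_chebU_deriv_orth ?mulr0 //; move: sG; move: (size G) => k; lia.
Qed.
End QuadratureInstances.

(** * The dual certificate *)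

Section DualCertificate.
Variable R : realType.
Implicit Types (N M k m n j : nat) (a x y r nu : R) (F G p q : {poly R}).

Local Notation U n x := (chebU R n).[x].

Lemma cos_rec k a :
  cos (k.+2%:R * a) = 2 * cos a * cos (k.+1%:R * a) - cos (k%:R * a).
Proof.
have -> : k.+2%:R * a = k.+1%:R * a + a by rewrite -[in LHS]natr1; ring.
have -> : k%:R * a = k.+1%:R * a - a by rewrite -[in RHS]natr1; ring.
by rewrite cosB cosD; ring.
Qed.

Lemma chebU_subr_cos k a :
  U k.+2 (cos a) - U k (cos a) = 2 * cos (k.+2%:R * a).
Proof.
suff: U k.+2 (cos a) - U k (cos a) = 2 * cos (k.+2%:R * a) /\
      U k.+3 (cos a) - U k.+1 (cos a) = 2 * cos (k.+3%:R * a) by case.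
elim: k => [|k [IH1 IH2]].
  rewrite !cos_rec mul1r mul0r cos0 !hornerUSS hornerU1 hornerU0.
  by split; ring.
split=> //; rewrite [cos (k.+4%:R * a)]cos_rec mulrBr -IH1.
have -> : 2 * (2 * cos a * cos (k.+3%:R * a)) = 2 * cos a * (2 * cos (k.+3%:R * a)).
  by ring.
by rewrite -IH2 (hornerUSS k.+2) (hornerUSS k); ring.
Qed.

Definition sqr_subst : {poly R} := 1 - 2%:P * 'X^2.

Lemma horner_sqr_subst x : sqr_subst.[x] = 1 - 2 * x ^+ 2.
Proof. by rewrite /sqr_subst !hornerE. Qed.

Lemma horner_sqr_subst_cos a : sqr_subst.[cos a] = - cos (2 * a).
Proof.
rewrite horner_sqr_subst; have -> : 2 * a = a *+ 2 by rewrite mulr_natl.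
by rewrite cos_mulr2n; ring.
Qed.

Lemma sum_cos_double M k : (0 < k < M)%N ->
  \sum_(j < M) cos (k%:R * (2 * node R M j)) = 0.
Proof.
move=> kM; rewrite -[RHS](@sum_cos_node R M (k * 2)); last by lia.
by apply: eq_bigr => j _; rewrite natrM mulrA.
Qed.

Lemma sum_trig_terms M (c0 c1 c2 c3 c4 : R) : (4 < M)%N ->
  \sum_(j < M) (c0 + c1 * cos (1%:R * (2 * node R M j))
    + c2 * cos (2%:R * (2 * node R M j)) + c3 * cos (3%:R * (2 * node R M j))
    + c4 * cos (4%:R * (2 * node R M j))) = M%:R * c0.
Proof.
move=> M4; rewrite !big_split /= -!mulr_sumr !sum_cos_double; try lia.
by rewrite !mulr0 !addr0 sumr_const card_ord mulr_natl.
Qed.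

(** For k >= 1 the moment is independent of k: U_{k+2} - U_k is a single cosine, of frequency too
    high to contribute. The cases k = 0, 1, 2 are expanded into cosines of the doubled angle, of
    which only the constant term survives. *)
Lemma Lam_chebU_comp M nu k : (k.*2 + 10 <= M)%N ->
  Lam M ((chebU R k \Po sqr_subst) * ('X^2 - (nu ^+ 2)%:P))
  = M%:R * ((k == 0%N)%:R / 8 - nu ^+ 2 / 2).
Proof.
have E F : Lam M ((F \Po sqr_subst) * ('X^2 - (nu ^+ 2)%:P)) =
  \sum_(j < M) (F.[- cos (2 * node R M j)] * ((1 - cos (2 * node R M j)) / 2)
    * ((1 + cos (2 * node R M j)) / 2 - nu ^+ 2)).
  apply: eq_bigr => j _; rewrite hornerM horner_comp horner_sqr_subst_cos.
  rewrite hornerD hornerN hornerXn hornerC.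
  set s := node R M j; have -> : 2 * s = s *+ 2 by rewrite mulr_natl.
  by rewrite cos_mulr2n; field.
elim/ltn_ind: k => k IH hM; rewrite E.
have cs a : [/\ cos (1%:R * a) = cos a, cos (2%:R * a) = 2 * cos a ^+ 2 - 1,
   cos (3%:R * a) = 4 * cos a ^+ 3 - 3 * cos a &
   cos (4%:R * a) = 8 * cos a ^+ 4 - 8 * cos a ^+ 2 + 1].
  by rewrite !cos_rec mul1r mul0r cos0; split; ring.
case: k IH hM => [|[|[|k]]] IH hM.
- rewrite eqxx -(@sum_trig_terms M _ (nu ^+ 2 / 2) (- 8^-1) 0 0); last by lia.
  apply: eq_bigr => j _; have [-> -> -> ->] := cs (2 * node R M j).
  by rewrite hornerU0 /=; field.
- rewrite -(@sum_trig_terms M _ (nu ^+ 2 - 8^-1) (- nu ^+ 2 / 2) 8^-1 0); last by lia.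
  apply: eq_bigr => j _; have [-> -> -> ->] := cs (2 * node R M j).
  by rewrite hornerU1 /=; field.
- rewrite -(@sum_trig_terms M _ (nu ^+ 2) (8^-1 - nu ^+ 2) (nu ^+ 2 / 2) (- 8^-1)); last by lia.
  apply: eq_bigr => j _; have [-> -> -> ->] := cs (2 * node R M j).
  by rewrite hornerUSS hornerU1 hornerU0 /=; field.
have := IH k.+1 (ltnW (ltnSn _)); rewrite E => <-; last by lia.
apply/eqP; rewrite -subr_eq0 -sumrB.
(* The weight 1 - x^2 and the factor x^2 - nu^2 have degree 4 together, below the frequency 2(k+3).
   The sign comes from the parity of U at -cos 2s. *)
pose G : {poly R} := (2 * (-1) ^+ k.+1) *: ((1 - 'X^2) * ('X^2 - (nu ^+ 2)%:P)).
have sG : (size G <= 5)%N.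
  apply: leq_trans (size_scale_leq _ _) _.
  apply: leq_trans (size_polyMleq _ _) _.
  by rewrite -opprB size_polyN -polyC1 !size_XnsubC.
apply/eqP.
transitivity (\sum_(j < M) cos ((k.+3 * 2)%:R * node R M j) * G.[cos (node R M j)]).
  apply: eq_bigr => j _; set s := node R M j.
  have -> : (k.+3 * 2)%:R * s = k.+3%:R * (2 * s) by rewrite natrM mulrA.
  rewrite /G hornerZ !hornerM !hornerD !hornerN !hornerXn !hornerC.
  have := chebU_subr_cos k.+1 (2 * s) => /(canRL (subrK _)) e.
  rewrite !chebU_opp e; have -> : 2 * s = s *+ 2 by rewrite mulr_natl.
  by rewrite cos_mulr2n !exprS; field.
apply: sum_cos_poly_node; first by apply: leq_trans sG _; lia.
by move: sG; move: (size G) => g; lia.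
Qed.

Definition altP N q : {poly R} :=
  \sum_(1 <= k < N.+1) q`_k *: chebU R k.-1.

Definition sqP N q : {poly R} := altP N q \Po sqr_subst.

Lemma altP_cos N q t :
  (altP N q).[cos t] * sin t = \sum_(1 <= k < N.+1) q`_k * sin (k%:R * t).
Proof.
rewrite horner_sum mulr_suml !big_add1 /=; apply: eq_bigr => k _.
by rewrite hornerZ -mulrA chebU_cos_mul.
Qed.

(** All moments agree except the one for q_1, whose excess 1/8 equals nu^2/2 times 1/(4 nu^2). *)
Lemma Lam_sqP N M nu q : (0 < N)%N -> (N.*2 + 10 <= M)%N -> nu != 0 ->
  Lam M (sqP N q * ('X^2 - (nu ^+ 2)%:P)) = M%:R * (nu ^+ 2 / 2) *
    (1 / (4 * nu ^+ 2) * q`_1 - \sum_(1 <= k < N.+1) q`_k).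
Proof.
move=> N0 hM nu0.
rewrite /sqP /altP raddf_sum /= mulr_suml Lam_sum.
transitivity (\sum_(1 <= k < N.+1) q`_k *
   (M%:R * ((k == 1%N)%:R / 8 - nu ^+ 2 / 2))).
  rewrite !big_add1 /= !big_mkord; apply: eq_bigr => k _.
  rewrite linearZ /= -scalerAl LamZ Lam_chebU_comp ?eqSS //.
  by have := ltn_ord k; lia.
rewrite mulrBr !mulr_sumr.
transitivity (\sum_(1 <= k < N.+1) q`_k * (M%:R * ((k == 1%N)%:R / 8))
    - \sum_(1 <= k < N.+1) M%:R * (nu ^+ 2 / 2) * q`_k).
  by rewrite -sumrB; apply: eq_bigr => k _; ring.
congr (_ - _); rewrite big_ltn // big_nat big1 ?addr0.
  by rewrite eqxx /=; field.
by move=> k /andP[k1 _]; rewrite gtn_eqF // mul0r !mulr0.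
Qed.

Lemma size_sqr_subst : size sqr_subst = 3.
Proof.
rewrite /sqr_subst mul_polyC addrC size_polyDl size_polyN size_scale ?pnatr_eq0 //.
  by rewrite size_polyXn.
by rewrite size_polyXn size_poly1.
Qed.

Lemma size_altP N q : (size (altP N q) <= N)%N.
Proof.
rewrite /altP; elim: N => [|n IHn]; first by rewrite big_geq // size_poly0.
rewrite big_nat_recr //=; apply: leq_trans (size_polyD _ _) _.
rewrite geq_max (leq_trans IHn) //=.
by rewrite (leq_trans (size_scale_leq _ _)) // size_chebU.
Qed.

(** Multiplication by 1 - e moves a point of the closed interval into the open one, where a negative
    value would persist by continuity. *)
Lemma poly_ge0_closed p : (forall x, -1 < x < 1 -> 0 <= p.[x]) ->
  forall x, -1 <= x <= 1 -> 0 <= p.[x].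
Proof.
move=> h x /andP[x1 x2]; rewrite leNgt; apply/negP => px.
have e0 : 0 < `|p.[x]| by rewrite normr_gt0 lt_eqF.
have [d d0 hd] := poly_cont x p e0.
pose e := Num.min (d / 2) (1 / 2).
have e1 : 0 < e by rewrite lt_min !divr_gt0.
have /andP[e2 e3] : (e <= d / 2) && (e <= 1 / 2) by rewrite !ge_min !lexx orbT.
have := hd (x * (1 - e)).
have -> : x * (1 - e) - x = - (x * e) by ring.
have -> : `|- (x * e)| < d.
  rewrite normrN ltr_norml; apply/andP; split; nra.
move=> /(_ isT); rewrite (ltr0_norm px) ltr_distl => /andP[_].
rewrite subrr => py; have := h (x * (1 - e)); rewrite leNgt py.
have -> : -1 < x * (1 - e) < 1 by apply/andP; split; nra.
by move=> /(_ isT).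
Qed.

Lemma sqP_ge0 N q : admissible N q -> forall x, -1 <= x <= 1 -> 0 <= (sqP N q).[x].
Proof.
case=> _ _ _ hq x /andP[x1 x2]; rewrite horner_comp horner_sqr_subst.
apply: poly_ge0_closed => [y hy|]; last by apply/andP; split; nra.
have /andP[y1 y2] := hy.
have yW : -1 <= y <= 1 by rewrite !ltW.
have t0 : 0 < acos y by rewrite acos_gt0 // y2 ltW.
have tpi : acos y < pi by rewrite acos_ltpi // y1 ltW.
have ht : 0 <= acos y <= pi by rewrite !ltW.
have := hq _ ht; rewrite -altP_cos acosK ?in_itv //.
by rewrite pmulr_lge0 // sin_gt0_pi // t0.
Qed.

Lemma altP_eq0 N q : altP N q = 0 -> forall k, (0 < k <= N)%N -> q`_k = 0.
Proof.
elim: N => [|N IH]; first by move=> _ k; lia.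
rewrite /altP big_nat_recr //= => h.
have qN : q`_N.+1 = 0.
  have := congr1 (fun p : {poly R} => p`_N) h; rewrite coefD coefZ coef0.
  rewrite (nth_default 0 (size_altP N q)) add0r => /eqP; rewrite mulf_eq0 => /orP[/eqP //|].
  have := lead_coef_eq0 (chebU R N); rewrite /lead_coef size_chebU /= => ->.
  by rewrite -size_poly_eq0 size_chebU.
move=> k /andP[k0]; rewrite leq_eqVlt => /orP[/eqP -> //|kN].
apply: IH; last by rewrite k0.
by move: h; rewrite qN scale0r addr0.
Qed.

Lemma sqPZD N a p q : sqP N (a *: p + q) = a *: sqP N p + sqP N q.
Proof.
rewrite /sqP /altP -linearZ -linearD /=; congr (_ \Po _).
rewrite scaler_sumr -big_split; apply: eq_bigr => k _ /=.
by rewrite coefD coefZ scalerDl scalerA.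
Qed.

Lemma sqP_eq0 N q : sqP N q = 0 -> forall k, (0 < k <= N)%N -> q`_k = 0.
Proof.
move=> h; apply: altP_eq0; apply/eqP.
by rewrite -(@comp_poly_eq0 _ _ sqr_subst) ?size_sqr_subst // -/(sqP N q) h.
Qed.

Lemma size_sqP N q : (0 < N)%N -> (size (sqP N q) <= N.*2.-1)%N.
Proof.
move=> N0; apply: leq_trans (size_comp_poly_leq _ _) _; rewrite size_sqr_subst.
by have := size_altP N q; move: (size (altP N q)) => n; lia.
Qed.

(** Nonnegativity of the functional bounds the coefficient sum by 1/(4 nu^2). Two maximizers have
    proportional [sqP]; the normalization q_1 = 1 fixes the ratio, and [sqP] determines the
    coefficients 1 to N. *)
Lemma extremal_of_quadrature N M nu rs es w p0 :
  (0 < N)%N -> (N.*2 + 10 <= M)%N -> quadrature N M nu rs es w ->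
  admissible N p0 -> \sum_(1 <= k < N.+1) p0`_k = 1 / (4 * nu ^+ 2) ->
  extremal N p0 /\
  forall q, extremal N q -> forall k, (0 < k <= N)%N -> q`_k = p0`_k.
Proof.
move=> N0 hM Q adm sum0.
have nu0 : nu != 0 by rewrite gt_eqF // (quad_gt0 Q).
have c0 : 0 < M%:R * (nu ^+ 2 / 2) :> R.
  by rewrite mulr_gt0 ?divr_gt0 ?exprn_gt0 ?(quad_gt0 Q) ?ltr0n //; lia.
have upper q : admissible N q ->
    \sum_(1 <= k < N.+1) q`_k <= \sum_(1 <= k < N.+1) p0`_k.
  move=> admq; have := quad_ge0 Q (size_sqP q N0) (sqP_ge0 admq).
  case: (admq) => _ _ q1 _; rewrite Lam_sqP // q1 mulr1.
  by rewrite pmulr_rge0 // subr_ge0 sum0.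
have tight q : admissible N q ->
    \sum_(1 <= k < N.+1) q`_k = \sum_(1 <= k < N.+1) p0`_k ->
    exists a, sqP N q = a *: quad_cofactor nu rs es.
  move=> admq sq; apply: (quad_eq0 Q (size_sqP q N0) (sqP_ge0 admq)).
  case: (admq) => _ _ q1 _.
  by rewrite Lam_sqP // q1 mulr1 sq sum0 subrr mulr0.
split; first by split.
move=> q [admq extq].
have [a qa] : exists a, sqP N q = a *: quad_cofactor nu rs es.
  by apply: tight => //; apply/eqP; rewrite eq_le upper ?extq.
have [b pb] := tight p0 adm erefl.
case: (adm) => _ _ p1 _; case: (admq) => _ _ q1 _.
have one : (0 < 1 <= N)%N by rewrite N0.
have b0 : b != 0.
  apply/eqP => b0; move: pb; rewrite b0 scale0r => /sqP_eq0 /(_ 1%N one).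
  by rewrite p1; apply/eqP/oner_neq0.
have : sqP N (- (a / b) *: p0 + q) = 0.
  by rewrite sqPZD qa pb scalerA mulNr divfK // scaleNr addNr.
move=> /sqP_eq0 z; have ab : a / b = 1.
  have := z 1%N one; rewrite coefD coefZ p1 q1 mulr1 => /eqP.
  by rewrite addrC subr_eq0 => /eqP.
move=> k kN; have := z k kN; rewrite coefD coefZ ab mulN1r addrC => /eqP.
by rewrite subr_eq0 => /eqP.
Qed.
End DualCertificate.

(** * Autocorrelation and the primal solution *)

Section Autocorrelation.
Variable R : realType.
Implicit Types (N k m n i j : nat) (a z : nat -> R) (t : R).

Definition acorr a N k : R := \sum_(0 <= i < N - k) a i * a (i + k)%N.

Lemma acorr_ge a N k : (N <= k)%N -> acorr a N k = 0.
Proof. by move=> h; rewrite /acorr big_geq //; lia. Qed.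

Lemma acorrS a N k : (k <= N)%N ->
  acorr a N.+1 k = acorr a N k + a (N - k)%N * a N.
Proof. by move=> kN; rewrite /acorr subSn // big_nat_recr //= subnK. Qed.

(** The argument of f is |i - j| in truncated subtraction. Passing to N+1 adds a border row and
    column, which contribute the same sum S. *)
Lemma toeplitz_form a N (f : nat -> R) :
  \sum_(0 <= i < N) \sum_(0 <= j < N) a i * a j * f ((i - j) + (j - i))%N
  = acorr a N 0 * f 0%N + 2 * \sum_(1 <= k < N) acorr a N k * f k.
Proof.
elim: N => [|N IH].
  by rewrite /acorr !big_geq // mul0r mulr0 addr0.
pose S := \sum_(0 <= i < N) a i * a N * f (N - i)%N.
rewrite big_nat_recr //=.
under eq_bigr do rewrite big_nat_recr //=.
rewrite big_split /= IH big_nat_recr //=.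
have -> : \sum_(0 <= i < N) a i * a N * f (i - N + (N - i))%N = S.
  rewrite /S !big_nat; apply: eq_bigr => i /andP[_ iN].
  by have -> : (i - N + (N - i) = N - i)%N by lia.
have -> : \sum_(0 <= i < N) a N * a i * f (N - i + (i - N))%N = S.
  rewrite /S !big_nat; apply: eq_bigr => i /andP[_ iN].
  have -> : (N - i + (i - N) = N - i)%N by lia.
  by ring.
rewrite subnn addn0 acorrS // subn0.
have -> : \sum_(1 <= k < N.+1) acorr a N.+1 k * f k
    = \sum_(1 <= k < N) acorr a N k * f k + S.
  transitivity (\sum_(1 <= k < N.+1) (acorr a N k * f k + a (N - k)%N * a N * f k)).
    rewrite !big_nat; apply: eq_bigr => k /andP[_ kN].
    by rewrite acorrS // mulrDl.
  rewrite big_split /=; congr (_ + _).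
    case: N {IH S} => [|N]; first by rewrite !big_geq.
    by rewrite big_nat_recr //= acorr_ge // mul0r addr0.
  rewrite big_nat_rev /= big_add1 /= /S !big_nat; apply: eq_bigr => i /andP[_ iN].
  rewrite addSn add0n !subSS.
  by have -> : (N - (N - i) = i)%N by lia.
ring.
Qed.

Lemma sum_acorr_parts (c g : nat -> R) N : (0 < N)%N -> g 0%N = 0 ->
  \sum_(1 <= k < N.+1) (c k.-1 - c k.+1) * g k
  = c 0%N * g 1%N + \sum_(1 <= k < N) c k * (g k.+1 - g k.-1)
    - c N * g N.-1 - c N.+1 * g N.
Proof.
case: N => // N _ g0; elim: N => [|N IH].
  by rewrite big_nat1 big_geq //= g0; ring.
by rewrite big_nat_recr //= IH [in RHS]big_nat_recr //=; ring.
Qed.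

Lemma sum_delta_acorr a N d (x : R) : (0 < d)%N ->
  \sum_(1 <= k < N) acorr a N k * (if k == d then x else 0) = acorr a N d * x.
Proof.
move=> d0; under eq_bigr => k _ do
  (have -> : acorr a N k * (if k == d then x else 0)
     = if k == d then acorr a N k * x else 0 by case: ifP; rewrite ?mulr0).
rewrite -big_mkcond big_nat1_eq d0 /=; case: ltnP => // h.
by rewrite acorr_ge // mul0r.
Qed.

(** This is |sum_j a_j e^{ijt}|^2, expanded by diagonals. *)
Lemma cos_form_ge0 a N t :
  0 <= acorr a N 0 + 2 * \sum_(1 <= k < N) acorr a N k * cos (k%:R * t).
Proof.
have := toeplitz_form a N (fun d => cos (d%:R * t)).
rewrite mul0r cos0 mulr1 => <-.
rewrite (_ : \sum_(_ <= _ < _) _ =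
  (\sum_(0 <= i < N) a i * cos (i%:R * t)) ^+ 2
  + (\sum_(0 <= i < N) a i * sin (i%:R * t)) ^+ 2).
  by rewrite addr_ge0 // sqr_ge0.
rewrite !expr2 !mulr_suml -big_split /=; apply: eq_bigr => i _.
rewrite !mulr_sumr -big_split /=; apply: eq_bigr => j _.
have -> : cos ((i - j + (j - i))%:R * t) = cos (i%:R * t - j%:R * t).
  case: (leqP i j) => ij.
    have -> : (i - j + (j - i) = j - i)%N by lia.
    by rewrite natrB // -cosN; congr cos; ring.
  have -> : (i - j + (j - i) = i - j)%N by lia.
  by rewrite natrB 1?ltnW //; congr cos; ring.
by rewrite cosB; ring.
Qed.

Lemma sum_shift2 (f : nat -> R) n :
  \sum_(0 <= i < n) f i.+2 = \sum_(0 <= i < n) f i + f n + f n.+1 - f 0%N - f 1%N.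
Proof.
elim: n => [|n IH]; first by rewrite !big_geq //; ring.
by rewrite !big_nat_recr //= IH; ring.
Qed.

(** With b the extension of a by zero, twice the difference is the sum of all (b_i - b_{i+2})^2 plus
    b_0^2 + b_1^2; if this vanishes, b vanishes step by step. *)
Lemma acorr_denom_gt0 a N : (exists2 i, (i < N)%N & a i != 0) ->
  0 < acorr a N 0 - acorr a N 2.
Proof.
case=> i0 i0N ai0.
pose b i := if (i < N)%N then a i else 0.
have bN i : (N <= i)%N -> b i = 0 by rewrite /b ltnNge => ->.
have c0 : acorr a N 0 = \sum_(0 <= i < N) b i ^+ 2.
  rewrite /acorr subn0 !big_nat; apply: eq_bigr => i /andP[_ iN].
  by rewrite addn0 /b iN expr2.
have c2 : acorr a N 2 = \sum_(0 <= i < N) b i * b i.+2.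
  rewrite /acorr (big_nat_widen 0 _ N) ?leq_subr // big_mkcond /= !big_nat.
  apply: eq_bigr => i /andP[_ iN]; rewrite /b iN addn2.
  have -> : (i < N - 2)%N = (i.+2 < N)%N by lia.
  by case: ifP; rewrite ?mulr0.
have key : 2 * (acorr a N 0 - acorr a N 2) =
   \sum_(0 <= i < N) (b i - b i.+2) ^+ 2 + (b 0%N ^+ 2 + b 1%N ^+ 2).
  have := sum_shift2 (fun i => b i ^+ 2) N; rewrite -c0 (bN N) // (bN N.+1) // => h.
  transitivity (acorr a N 0 - 2 * acorr a N 2 +
     (\sum_(0 <= i < N) b i.+2 ^+ 2) + (b 0%N ^+ 2 + b 1%N ^+ 2)).
    by rewrite h; ring.
  congr (_ + _); rewrite c0 c2 mulr_sumr -sumrB -big_split /=.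
  by apply: eq_bigr => i _; ring.
have s0 : 0 <= \sum_(0 <= i < N) (b i - b i.+2) ^+ 2.
  by apply: sumr_ge0 => i _; apply: sqr_ge0.
suff : 0 < 2 * (acorr a N 0 - acorr a N 2) by rewrite pmulr_rgt0.
rewrite lt_def key addr_ge0 ?addr_ge0 ?sqr_ge0 // andbT.
apply: contraNneq ai0 => /eqP.
rewrite paddr_eq0 ?addr_ge0 ?sqr_ge0 // => /andP[h].
rewrite paddr_eq0 ?sqr_ge0 // !sqrf_eq0 => /andP[/eqP b0 /eqP b1].
have step i : (i < N)%N -> b i.+2 = b i.
  move=> iN; move: h; rewrite big_mkord psumr_eq0 => [|j _]; last exact: sqr_ge0.
  move=> /allP /(_ (Ordinal iN)); rewrite mem_index_enum => /(_ isT) /=.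
  by rewrite sqrf_eq0 subr_eq0 => /eqP.
have bz i : b i = 0 /\ b i.+1 = 0.
  elim: i => [//|i [h1 h2]]; split=> //.
  by have [/step -> //|iN] := ltnP i N; apply: bN; lia.
by have [+ _] := bz i0; rewrite /b i0N => ->.
Qed.

(** These are the sine coefficients of sin t |sum_j a_j e^{ijt}|^2, by 2 sin t cos kt = sin((k+1)t)
    - sin((k-1)t), normalized to coefficient 1 at sin t. *)
Definition extremal_candidate a N : {poly R} :=
  \poly_(k < N.+1) (if k == 0%N then 0 else
    (acorr a N k.-1 - acorr a N k.+1) / (acorr a N 0 - acorr a N 2)).

Lemma coef_candidate a N k : (0 < k <= N)%N -> (extremal_candidate a N)`_k
  = (acorr a N k.-1 - acorr a N k.+1) / (acorr a N 0 - acorr a N 2).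
Proof. by case: k => // k /andP[_ kN]; rewrite coef_poly ltnS kN. Qed.

Lemma candidate_sum a N (g : nat -> R) : (0 < N)%N -> g 0%N = 0 ->
  \sum_(1 <= k < N.+1) (extremal_candidate a N)`_k * g k
  = (acorr a N 0 * g 1%N + \sum_(1 <= k < N) acorr a N k * (g k.+1 - g k.-1))
    / (acorr a N 0 - acorr a N 2).
Proof.
move=> N0 g0; have := sum_acorr_parts (acorr a N) N0 g0.
rewrite (acorr_ge a (leqnn N)) (acorr_ge a (leqnSn N)) !mul0r !subr0 => <-.
rewrite mulr_suml !big_nat.
by apply: eq_bigr => k kN; rewrite coef_candidate // mulrAC.
Qed.

Lemma candidate_admissible a N : (0 < N)%N -> 0 < acorr a N 0 - acorr a N 2 ->
  admissible N (extremal_candidate a N).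
Proof.
move=> N0 d0; split.
- exact: size_poly.
- by rewrite coef_poly.
- by rewrite coef_candidate ?N0 //= divff // gt_eqF.
move=> t tpi.
rewrite (candidate_sum _ (g := fun k => sin (k%:R * t))) ?mul0r ?sin0 //.
rewrite divr_ge0 ?(ltW d0) // mul1r.
have -> : acorr a N 0 * sin t + \sum_(1 <= k < N)
    acorr a N k * (sin (k.+1%:R * t) - sin (k.-1%:R * t)) =
  (acorr a N 0 + 2 * \sum_(1 <= k < N) acorr a N k * cos (k%:R * t)) * sin t.
  rewrite mulrDl; congr (_ + _); rewrite -mulrA mulr_suml mulr_sumr !big_nat.
  apply: eq_bigr => -[|k] //= _.
  have -> : k.+2%:R * t = k.+1%:R * t + t by rewrite -[in LHS]natr1; ring.
  have -> : k%:R * t = k.+1%:R * t - t by rewrite -[in RHS]natr1; ring.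
  by rewrite sinB sinD; ring.
by rewrite mulr_ge0 ?cos_form_ge0 // sin_ge0_pi.
Qed.

Lemma candidate_sum1 a N : (0 < N)%N ->
  \sum_(1 <= k < N.+1) (extremal_candidate a N)`_k
  = (acorr a N 0 + acorr a N 1) / (acorr a N 0 - acorr a N 2).
Proof.
move=> N0.
(* With g the indicator of k != 0, summation by parts leaves a nonzero difference of g only at k =
   1. *)
have -> : \sum_(1 <= k < N.+1) (extremal_candidate a N)`_k =
  \sum_(1 <= k < N.+1) (extremal_candidate a N)`_k * (k != 0%N)%:R.
  by rewrite !big_nat; apply: eq_bigr => -[|k] //= _; rewrite mulr1.
rewrite candidate_sum //= mulr1; congr ((_ + _) / _).
rewrite -[RHS]mulr1 -(sum_delta_acorr a N) // !big_nat.
by apply: eq_bigr => -[|[|k]] //= _; rewrite ?subr0 ?subrr ?mulr0.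
Qed.

(** Pair the pencil equation with the transpose of Z: both matrices are Toeplitz, so their quadratic
    forms are combinations of autocorrelations. *)
Lemma principal_vector_acorr N (lambda : R) z :
  principal_vector lambda (coord_vec N z) ->
  acorr (fun i => z i.+1) N 0 + acorr (fun i => z i.+1) N 1
  = lambda * (acorr (fun i => z i.+1) N 0 - acorr (fun i => z i.+1) N 2).
Proof.
move=> [_ E]; set a := fun i => z i.+1; set Z := coord_vec N z in E.
have form (f : nat -> R) (C : 'M[R]_N) :
    (forall i j : 'I_N, C i j = f ((i - j) + (j - i))%N) ->
    (Z^T *m (C *m Z)) 0 0
    = acorr a N 0 * f 0%N + 2 * \sum_(1 <= k < N) acorr a N k * f k.
  move=> Cf; rewrite -toeplitz_form big_mkord mxE; apply: eq_bigr => i _.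
  rewrite big_mkord !mxE mulr_sumr; apply: eq_bigr => j _.
  by rewrite Cf !mxE /a; ring.
have dist (i j : nat) d : (`|i%:Z - j%:Z| == d%:Z) = (i - j + (j - i) == d)%N.
  by apply/eqP/eqP; lia.
pose f1 d : R := (if d == 0%N then 1 else 0) + (if d == 1%N then 2^-1 else 0).
pose f2 d : R := (if d == 0%N then 1 else 0) + (if d == 2 then - 2^-1 else 0).
have ev (f : nat -> R) d x : (0 < d)%N ->
    (forall k, f k = (if k == 0%N then 1 else 0) + (if k == d then x else 0)) ->
    acorr a N 0 * f 0%N + 2 * \sum_(1 <= k < N) acorr a N k * f k
    = acorr a N 0 + acorr a N d * (2 * x).
  move=> d0 fE; rewrite fE eqxx ltn_eqF // addr0 mulr1; congr (_ + _).
  rewrite mulrCA -(sum_delta_acorr a N x d0); congr (_ * _); rewrite !big_nat.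
  by apply: eq_bigr => -[|k] //= _; rewrite fE add0r.
have hA (i j : 'I_N) : (1%:M + matA R N) i j = f1 ((i - j) + (j - i))%N.
  rewrite !mxE dist /f1 -val_eqE /=; congr (_ + _).
  have -> : (i - j + (j - i) == 0)%N = (i == j :> nat) by apply/eqP/eqP; lia.
  by case: eqP.
have hB (i j : 'I_N) : (1%:M - matB R N) i j = f2 ((i - j) + (j - i))%N.
  rewrite !mxE dist /f2 -val_eqE /=; congr (_ + _).
    have -> : (i - j + (j - i) == 0)%N = (i == j :> nat) by apply/eqP/eqP; lia.
    by case: eqP.
  by case: ifP; rewrite ?oppr0.
have := form f1 _ hA; rewrite E -scalemxAr mxE (form f2 _ hB).
rewrite (ev f1 1%N 2^-1) // (ev f2 2 (- 2^-1)) // mulrN divff ?pnatr_eq0 //.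
by rewrite mulr1 mulrN1.
Qed.
End Autocorrelation.

(** * Explicit coefficients and location of the roots *)

Section Assembly.
Variable R : realType.
Implicit Types (N k m n i j : nat) (z : nat -> R) (mu nu x : R) (p : {poly R}).

(** For k = N-1 and k = N the subtracted autocorrelation is an empty sum, hence the separate
    formulas. *)
Lemma candidate_formulas N z p : (0 < N)%N ->
  (forall k, (0 < k <= N)%N ->
    p`_k = (extremal_candidate (fun i => z i.+1) N)`_k) ->
  coeff_formulas N z p.
Proof.
move=> N0 pE; set a := fun i => z i.+1 in pE.
have cE k : (0 < k <= N)%N ->
    p`_k = (acorr a N k.-1 - acorr a N k.+1) / alpha_denom N z.
  move=> kN; rewrite pE // coef_candidate //; congr (_ / (_ - _)).
    rewrite /acorr subn0 big_add1 /=.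
    by apply: eq_bigr => i _; rewrite addn0.
  rewrite /acorr big_add1 /= (_ : N.-2 = N - 2)%N; last by lia.
  by apply: eq_bigr => i _; rewrite /a addn2.
split.
- move=> k kN; rewrite cE; last by lia.
  congr ((_ - _) / _); rewrite big_add1 /= /acorr.
    rewrite (_ : N - k.-1 = (N - k).+1)%N; last by lia.
    apply: eq_bigr => i _; congr (_ * z _); lia.
  rewrite (_ : N - k.+1 = (N - k).-1)%N; last by lia.
  by apply: eq_bigr => i _; congr (_ * z _); lia.
- move=> N1; rewrite cE; last by lia.
  rewrite prednK // (acorr_ge a (leqnn N)) subr0 /acorr.
  case: N N1 {N0 pE cE} => [|[|n]] // _.
  have e : (n.+2 - n = 2)%N by lia.
  by rewrite /= e !big_nat_recr //= big_geq // add0r add0n add1n.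
- rewrite cE ?N0 ?leqnn // (acorr_ge a (leqnSn N)) subr0 /acorr.
  case: N N0 {pE cE} => // n _.
  have e : (n.+1 - n = 1)%N by lia.
  by rewrite /= e big_nat1 add0n.
Qed.

Lemma extremal_formulas N M nu (rs es : seq R) w z :
  (0 < N)%N -> (N.*2 + 10 <= M)%N -> quadrature N M nu rs es w ->
  principal_vector (1 / (4 * nu ^+ 2)) (coord_vec N z) ->
  (exists p, extremal N p) /\ forall p, extremal N p -> coeff_formulas N z p.
Proof.
move=> N0 hM Q Z; set a := fun i => z i.+1.
have d0 : 0 < acorr a N 0 - acorr a N 2.
  apply: acorr_denom_gt0; case: Z => Z0 _.
  have [/existsP[i ai]|] := boolP [exists i : 'I_N, z i.+1 != 0]; first by exists i.
  rewrite negb_exists => /forallP h; case/eqP: Z0; apply/colP => i.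
  by rewrite !mxE; apply/eqP; have := h i; rewrite negbK.
have adm := candidate_admissible N0 d0.
have s1 : \sum_(1 <= k < N.+1) (extremal_candidate a N)`_k = 1 / (4 * nu ^+ 2).
  rewrite candidate_sum1 // (principal_vector_acorr Z) -/a mulfK //.
  by rewrite gt_eqF.
have [ext uniq_ext] := extremal_of_quadrature N0 hM Q adm s1.
split; first by exists (extremal_candidate a N).
by move=> p /uniq_ext pE; apply: candidate_formulas.
Qed.

(** For N = 2h+1 this sine is cos((h+1) pi/(N+2)), the root of index h in decreasing order; all
    later roots are negative. *)
Lemma least_pos_root_sin N : odd N ->
  least_pos_root (chebU R N.+1) (sin (pi / (2 * (N%:R + 2)))).
Proof.
move=> oN; have N2 : N = ((N./2).*2.+1)%N by rewrite -[LHS]odd_double_half oN.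
set h := N./2 in N2.
have n2 : N.+2%:R = N%:R + 2 :> R by rewrite -natrD addn2.
have n2p : 0 < N%:R + 2 :> R by rewrite -n2.
have nh : N%:R = 2 * h%:R + 1 :> R by rewrite N2 -natr1 -muln2 natrM mulrC.
have muE : sin (pi / (2 * (N%:R + 2))) = chebU_root R N.+1 h.
  rewrite /chebU_root -cosBpihalf -cosN n2; congr cos.
  by rewrite -natr1 nh in n2p *; field; rewrite gt_eqF.
have hN : (h < N.+1)%N by rewrite N2; lia.
split.
- apply: sin_gt0_pi; rewrite divr_gt0 ?pi_gt0 ?mulr_gt0 //=.
  rewrite ltr_pdivrMr ?mulr_gt0 // ltr_pMr ?pi_gt0 //.
  by have : 0 <= N%:R :> R by []; lra.
- by rewrite muE root_chebU.
move=> y y0 ry; rewrite muE.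
have [c c0 cE] := chebU_factor R N.+1.
move: ry; rewrite cE rootZ // root_prod_XsubC => /mapP[j].
rewrite mem_iota add0n => /andP[_ jN] yE.
have [jh|hj|jh] := ltngtP j h; last by rewrite yE jh.
- by rewrite yE; apply: ltW; apply: chebU_root_lt; rewrite jh hN.
- have : y < 0; last by rewrite ltNge ltW.
  have /andP[a1 a2] := @chebU_angle R N.+1 j jN.
  have pi0 := pi_gt0 R.
  have i1 : j.+1%:R * pi / N.+2%:R \in `[0, (pi : R)] by rewrite in_itv /= !ltW.
  have i2 : pi / 2 \in `[0, (pi : R)] by rewrite in_itv /=; apply/andP; split; lra.
  rewrite yE /chebU_root -cos_pihalf ltr_cos // n2 ltr_pdivlMr // mulrAC.
  rewrite ltr_pdivrMr // nh.
  have hj' : h%:R + 1 <= j%:R :> R by rewrite natr1 ler_nat.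
  by rewrite -natr1; nra.
Qed.

Lemma least_pos_root_deriv N : (1 < N)%N ->
  exists nu : R, [/\ least_pos_root (chebU R N.+1)^`() nu, nu != 0, nu ^+ 2 != 1 &
    (chebU R N.+1)^`().[nu] = 0].
Proof.
move=> N1; have [t [_ _ ti _ [c c0 cE]]] := chebU_deriv_roots R N.
have rt x : root (chebU R N.+1)^`() x -> x \in t.
  by rewrite cE rootZ // root_prod_XsubC.
have [nu hnu] := exists_least_pos_root rt (chebU_deriv_pos_root R N1).
case: (hnu) => nu0 rnu _; exists nu; split=> //; last exact/eqP.
  by rewrite gt_eqF.
by have := one_sub_sqr_gt0 (allP ti _ (rt _ rnu)); rewrite subr_gt0 => /lt_eqF ->.
Qed.
End Assembly.

Theorem theorem2 (R : realType) (N : nat) (hN : (0 < N)%N) :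
  [/\ exists p : {poly R}, extremal N p,
      odd N ->
        let mu : R := sin (pi / (2 * (N%:R + 2))) in
        [/\ least_pos_root (chebU R N.+1) mu,
            principal_vector (1 / (4 * mu ^+ 2)) (coord_vec N (zvec0 N mu)) &
            forall p : {poly R}, extremal N p -> coeff_formulas N (zvec0 N mu) p] &
      (1 < N)%N ->
        exists nu : R,
        [/\ least_pos_root (chebU R N.+1)^`() nu,
            principal_vector (1 / (4 * nu ^+ 2)) (coord_vec N (zvec1 N nu)) &
            ~~ odd N ->
            forall p : {poly R}, extremal N p -> coeff_formulas N (zvec1 N nu) p]].
Proof.
have oddN : odd N -> let mu : R := sin (pi / (2 * (N%:R + 2))) in
    [/\ least_pos_root (chebU R N.+1) mu,
        principal_vector (1 / (4 * mu ^+ 2)) (coord_vec N (zvec0 N mu)) &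
        (exists p : {poly R}, extremal N p) /\
        forall p : {poly R}, extremal N p -> coeff_formulas N (zvec0 N mu) p].
  move=> oN mu; have hmu := least_pos_root_sin R oN.
  case: (hmu) => mu0 rmu _.
  have pv : principal_vector (1 / (4 * mu ^+ 2)) (coord_vec N (zvec0 N mu)).
    by apply: principal_zvec0; [ | rewrite gt_eqF | apply/eqP].
  (* [leqnn] fixes M as 2N + 10. *)
  have [rs [es [w Q]]] := quadrature_odd oN (leqnn _) hmu.
  by split=> //; apply: extremal_formulas Q pv.
have evenN : (1 < N)%N -> exists nu : R,
    [/\ least_pos_root (chebU R N.+1)^`() nu,
        principal_vector (1 / (4 * nu ^+ 2)) (coord_vec N (zvec1 N nu)) &
        ~~ odd N -> (exists p : {poly R}, extremal N p) /\
        forall p : {poly R}, extremal N p -> coeff_formulas N (zvec1 N nu) p].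
  move=> N1; have [nu [hnu nu0 nu1 rnu]] := least_pos_root_deriv R N1.
  have pv := principal_zvec1 hN nu0 nu1 rnu.
  exists nu; split=> // eN.
  have [rs [es [w Q]]] := quadrature_even hN eN (leqnn _) hnu.
  exact: extremal_formulas hN (leqnn _) Q pv.
split.
- have [oN|eN] := boolP (odd N); first by case: (oddN oN) => _ _ [].
  have N1 : (1 < N)%N by case: N hN eN {oddN evenN} => [|[|n]].
  by case: (evenN N1) => nu [_ _ /(_ eN) []].
- by move=> oN mu; case: (oddN oN) => h1 h2 [_ h3].
- move=> N1; case: (evenN N1) => nu [h1 h2 h3]; exists nu; split=> // eN.
  by case: (h3 eN).
Qed.
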